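(* Let $n$ be a constant. There is a constant $c>0$ and an algorithm which, given constants $\epsilon,\gamma>0$ and an instance $(\mathcal N,\mathcal M,(v_i)_{i\in\mathcal N})$ with $|\mathcal N|=n$, $|\mathcal M|=m$, that is either a goods manna ($v_{ij}\ge0$ for all $i\in\mathcal N$, $j\in\mathcal M$) or a chores manna ($v_{ij}<0$ for all $i\in\mathcal N$, $j\in\mathcal M$), runs in time $2^{O(1/\min\{\epsilon^2,\gamma^2\})}\,\mathrm{poly}(m)$ and returns an allocation which, for some $\alpha\in(0,1]$, is $(\alpha-\epsilon)^+$-MMS and $\gamma$-PO, and such that for any $\alpha'\in(0,1]$ with $\alpha'>\alpha+\frac{1}{2^{m^c}}$ no $\alpha'$-MMS allocation exists. That is, there is a PTAS for finding $\alpha$-MMS and Pareto optimal allocations for the best possible $\alpha$ for a goods manna and for a chores manna with constantly many agents.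
   Context: Items in the finite set $\mathcal M$ are indivisible. Each agent $i$ has an additive valuation $v_i:2^{\mathcal M}\to\mathbb R$, $v_i(S)=\sum_{j\in S}v_{ij}$. For $c\in\mathbb R$, $c^+=\max\{c,0\}$. An allocation is a partition $A=(A_i)_{i\in\mathcal N}$ of all of $\mathcal M$ into $n$ (possibly empty) bundles, $A_i$ going to agent $i$; $\Pi_n(\mathcal M)$ is the set of allocations. $\mathrm{MMS}_i=\max_{(A_1,\dots,A_n)\in\Pi_n(\mathcal M)}\min_{k\in[n]}v_i(A_k)$. For $\alpha\in(0,1]$, $A$ is $\alpha$-MMS if for all $i$: $v_i(A_i)\ge\alpha\,\mathrm{MMS}_i$ when $\mathrm{MMS}_i\ge0$, and $v_i(A_i)\ge(1/\alpha)\mathrm{MMS}_i$ when $\mathrm{MMS}_i<0$; for $\alpha\le0$ every allocation is by convention $\alpha$-MMS. An allocation $A$ is $\gamma$-PO if there is no allocation $B\in\Pi_n(\mathcal M)$ such that for all $i$: $v_i(B_i)\ge(1+\gamma)v_i(A_i)$ if $v_i(A_i)\ge0$, and $v_i(B_i)\ge\frac{1}{1+\gamma}v_i(A_i)$ if $v_i(A_i)<0$, with at least one of these inequalities strict. The constant $n$ is absorbed in the $O$- and poly-notation. *)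

(* Defs.v *)
From HB Require Import structures.
From mathcomp Require Import all_boot all_order all_algebra.
From mathcomp Require Import all_classical all_reals all_analysis.

Set Implicit Arguments.
Unset Strict Implicit.
Unset Printing Implicit Defensive.

Import Order.TTheory GRing.Theory Num.Theory.
Local Open Scope ring_scope.

Section FairDivision.
Variables (R : realType) (n m : nat).
Implicit Types (v : 'I_n -> 'I_m -> R) (A B : {ffun 'I_n -> {set 'I_m}}).

Definition goods_manna v : Prop := forall i j, 0 <= v i j.
Definition chores_manna v : Prop := forall i j, v i j < 0.

Definition value v (i : 'I_n) (S : {set 'I_m}) : R := \sum_(j in S) v i j.

(* finset's [partition] is not used: it excludes empty blocks. *)
Definition allocations : {set {ffun 'I_n -> {set 'I_m}}} :=
  [set A : {ffun 'I_n -> {set 'I_m}} |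
    (\bigcup_i A i == [set: 'I_m])%SET
    && [forall i, forall k, (i != k) ==> [disjoint A i & A k]]].

(* The infinities are only the neutral elements of max and min: for [0 < n]
   both index sets are nonempty and the value is finite. *)
Definition MMS v (i : 'I_n) : R :=
  fine (\big[maxe/-oo%E]_(A in allocations)
          \big[mine/+oo%E]_(k < n) (value v i (A k))%:E).

Definition is_MMS v (alpha : R) A : Prop :=
  0 < alpha -> forall i,
    (0 <= MMS v i -> alpha * MMS v i <= value v i (A i)) /\
    (MMS v i < 0 -> alpha^-1 * MMS v i <= value v i (A i)).

(* The value agent [i] has to reach for an improvement on [A] by a factor
   [1 + gam]. *)
Definition improved v (gam : R) A (i : 'I_n) : R :=
  if 0 <= value v i (A i) then (1 + gam) * value v i (A i)
  else (1 + gam)^-1 * value v i (A i).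

Definition is_PO v (gam : R) A : Prop :=
  ~ exists B, [/\ B \in allocations,
      forall i, improved v gam A i <= value v i (B i)
    & exists i, improved v gam A i < value v i (B i)].

End FairDivision.

(* Model of computation: a real RAM. A program is a term of a while language
   over finitely many integer arrays and finitely many real arrays, with
   computed indices. The available operations are addition, truncated
   subtraction and comparison of natural numbers, and exact field arithmetic
   and comparison of real numbers; there is no rounding from reals to integers
   and the only real literals are 0 and 1. Each node of an expression that is
   evaluated and each command that is executed costs one unit of time. Division
   by 0 yields 0. *)

Inductive iexp : Type :=
  | ILit of nat
  | IGet of nat & iexp
  | IAdd of iexp & iexp
  | ISub of iexp & iexp.

Inductive rexp : Type :=
  | RZero
  | ROne
  | RGet of nat & iexp
  | RAdd of rexp & rexp
  | RSub of rexp & rexp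
  | RMul of rexp & rexp
  | RDiv of rexp & rexp.

Inductive bexp : Type :=
  | ILe of iexp & iexp
  | RLe of rexp & rexp
  | BNot of bexp
  | BAnd of bexp & bexp.

Inductive cmd : Type :=
  | Skip
  | ISet of nat & iexp & iexp
  | RSet of nat & iexp & rexp
  | Seq of cmd & cmd
  | If of bexp & cmd & cmd
  | While of bexp & cmd.

Fixpoint icost (e : iexp) : nat :=
  match e with
  | ILit _ => 1
  | IGet _ e1 => (icost e1).+1
  | IAdd e1 e2 | ISub e1 e2 => (icost e1 + icost e2).+1
  end.

Fixpoint rcost (e : rexp) : nat :=
  match e with
  | RZero | ROne => 1
  | RGet _ e1 => (icost e1).+1
  | RAdd e1 e2 | RSub e1 e2 | RMul e1 e2 | RDiv e1 e2 =>
      (rcost e1 + rcost e2).+1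
  end.

Fixpoint bcost (b : bexp) : nat :=
  match b with
  | ILe e1 e2 => (icost e1 + icost e2).+1
  | RLe e1 e2 => (rcost e1 + rcost e2).+1
  | BNot b1 => (bcost b1).+1
  | BAnd b1 b2 => (bcost b1 + bcost b2).+1
  end.

Section Semantics.
Variable R : realType.

(* [imem s a k] and [rmem s a k] are the entries of index [k] of the integer
   array and of the real array number [a]. *)
Record store : Type := Store {
  imem : nat -> nat -> nat;
  rmem : nat -> nat -> R }.

Definition update (T : Type) (f : nat -> nat -> T) (a k : nat) (x : T) :
    nat -> nat -> T :=
  fun b l => if (b == a) && (l == k) then x else f b l.

Fixpoint ieval (s : store) (e : iexp) : nat :=
  match e with
  | ILit k => k
  | IGet a e1 => imem s a (ieval s e1)
  | IAdd e1 e2 => (ieval s e1 + ieval s e2)%N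
  | ISub e1 e2 => (ieval s e1 - ieval s e2)%N
  end.

Fixpoint reval (s : store) (e : rexp) : R :=
  match e with
  | RZero => 0
  | ROne => 1
  | RGet a e1 => rmem s a (ieval s e1)
  | RAdd e1 e2 => reval s e1 + reval s e2
  | RSub e1 e2 => reval s e1 - reval s e2
  | RMul e1 e2 => reval s e1 * reval s e2
  | RDiv e1 e2 => reval s e1 / reval s e2
  end.

Fixpoint beval (s : store) (b : bexp) : bool :=
  match b with
  | ILe e1 e2 => (ieval s e1 <= ieval s e2)%N
  | RLe e1 e2 => reval s e1 <= reval s e2
  | BNot b1 => ~~ beval s b1
  | BAnd b1 b2 => beval s b1 && beval s b2
  end.

(* [exec c s t s']: started in [s], the program [c] halts in [s'] after [t]
   units of time. *)
Inductive exec : cmd -> store -> nat -> store -> Prop :=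
  | ExSkip s : exec Skip s 1 s
  | ExISet a e1 e2 s :
      exec (ISet a e1 e2) s (icost e1 + icost e2).+1
        (Store (update (imem s) a (ieval s e1) (ieval s e2)) (rmem s))
  | ExRSet a e1 e2 s :
      exec (RSet a e1 e2) s (icost e1 + rcost e2).+1
        (Store (imem s) (update (rmem s) a (ieval s e1) (reval s e2)))
  | ExSeq c1 c2 s1 s2 s3 t1 t2 :
      exec c1 s1 t1 s2 -> exec c2 s2 t2 s3 ->
      exec (Seq c1 c2) s1 (t1 + t2).+1 s3
  | ExIf b c1 c2 s s' t :
      exec (if beval s b then c1 else c2) s t s' ->
      exec (If b c1 c2) s (bcost b + t).+1 s'
  | ExWhileDone b c s :
      ~~ beval s b -> exec (While b c) s (bcost b).+1 s
  | ExWhileStep b c s1 s2 s3 t1 t2 :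
      beval s1 b -> exec c s1 t1 s2 -> exec (While b c) s2 t2 s3 ->
      exec (While b c) s1 (bcost b + t1 + t2).+1 s3.

Lemma exec_det c s t1 s1 t2 s2 :
  exec c s t1 s1 -> exec c s t2 s2 -> t1 = t2 /\ s1 = s2.
Proof.
move=> E1; elim: E1 t2 s2 => {c s t1 s1}; intros;
  match goal with E : exec _ _ _ _ |- _ => inversion E; subst; clear E end;
  repeat match goal with
  | nb : is_true (~~ ?x), hb : is_true ?x |- _ => by rewrite hb in nb
  | IH : forall t s, exec ?c ?s1 t s -> _, E : exec ?c ?s1 _ _ |- _ =>
      case: (IH _ _ E) => ? ?; subst; clear E
  end; by [].
Qed.

(* Integer array 0 is [m], real array 0 is [eps, gam], real array [i + 1] is
   the list of the values of the [m] items for agent [i]; all other entries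
   are 0. *)
Definition input (n m : nat) (eps gam : R) (v : 'I_n -> 'I_m -> R) : store :=
  Store (fun a => nth 0%N (nth [::] [:: [:: m]] a))
        (fun a => nth 0 (nth [::]
           ([:: eps; gam] :: [seq [seq v i j | j : 'I_m] | i : 'I_n]) a)).

(* Entry [j] of integer array 1 is the agent who gets item [j]. Items whose
   entry is not smaller than [n] are in no bundle. *)
Definition output (n m : nat) (s : store) : {ffun 'I_n -> {set 'I_m}} :=
  [ffun i : 'I_n => [set j : 'I_m | imem s 1 j == i :> nat]%SET].

End Semantics.

(* Main.v *)
Require Import Defs.
From HB Require Import structures.
From mathcomp Require Import all_boot all_order all_algebra.
From mathcomp Require Import all_classical all_reals all_analysis.
From mathcomp Require Import zify ring lra.

Set Implicit Arguments.
Unset Strict Implicit.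
Unset Printing Implicit Defensive.

Import Order.TTheory GRing.Theory Num.Theory.
Local Open Scope ring_scope.

(* A partial allocation is an assignment of the first items to agents; its
   profile collects the values of all n bundles for all n agents. Adding the
   items one at a time and keeping, among assignments whose profiles agree up
   to a factor r in every coordinate, only one, every assignment stays
   represented up to the factor r^m. A nonzero bundle value is pinned down up to
   the factor r by an item of the bundle worth at least 1/m of it and by the
   ratio of the two rounded to multiples of r - 1. So the number of assignments
   kept is polynomial in m and 1/(r - 1), whatever the magnitudes of the values.
   Here r is such that r^m <= 1 + min(1, eps/3, gam).

   The MMS values, up to the factor r^m, and the best ratio to them are then read
   off the final list. Among the listed assignments with the best ratio, capped
   at 1, one of maximum welfare is gam-PO: a gam-improvement of it would be
   represented in the list by an assignment that Pareto dominates it, at no worse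
   ratio. *)

(** * Trimmed lists of assignments *)

(** The machine cannot round a real to an integer, so a program cannot compute the cell of a load.
    Trimming therefore compares a new assignment with each one already kept, and cells serve only to
    count: two kept assignments never agree in all [n * n] cells. All [n * n] loads are tracked, not
    just the [n] loads of own bundles, because the MMS of an agent depends on that agent's value for
    every bundle. The sign condition on the manna enters where an item is added: without
    cancellation absolute values add up, so a common summand does not increase a relative error. The
    algorithm never computes [alpha]. Its output loses at most [eps] against every achievable ratio
    simultaneously, so the [alpha] of the theorem can be chosen afterwards, close to the supremum of
    these ratios. The lists are polynomial in [1 / eps] and [1 / gam]; the exponential in the time
    bound comes from estimating these by [expR] of the reciprocal of the smaller square. *)

Section Approximation.
Variable R : realType.
Implicit Types (c d x y a : R).

Definition same_sign x y := (0 <= x) && (0 <= y) || (x <= 0) && (y <= 0).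

(** Being purely multiplicative, it relates 0 to 0 alone, which is why zero loads get a cell of
    their own later. *)
Definition within c x y := (`|x| <= c * `|y|) && (`|y| <= c * `|x|).

Lemma within_refl c x : 1 <= c -> within c x x.
Proof. by move=> c1; rewrite /within andbb ler_peMl. Qed.

Lemma within_trans c d x y z :
  0 <= c -> 0 <= d -> within c x y -> within d y z -> within (c * d) x z.
Proof.
move=> c0 d0 /andP[xy yx] /andP[yz zy]; apply/andP; split.
  by apply: le_trans xy _; rewrite -mulrA ler_wpM2l.
by apply: le_trans zy _; rewrite (mulrC c) -mulrA ler_wpM2l.
Qed.

Lemma norm_sameD x a : same_sign x a -> `|x + a| = `|x| + `|a|.
Proof.
case/orP => /andP[x0 a0]; first by rewrite !ger0_norm// addr_ge0.
by rewrite !ler0_norm ?opprD//; lra.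
Qed.

(** Equal signs make absolute values additive, and [a] is trivially within a factor [c] of
    itself. *)
Lemma withinD c x y a : 1 <= c -> same_sign x a -> same_sign y a ->
  within c x y -> within c (x + a) (y + a).
Proof.
move=> c1 xa ya /andP[xy yx]; rewrite /within !norm_sameD//.
have ca : `|a| <= c * `|a| by rewrite ler_peMl.
by rewrite !mulrDr !lerD.
Qed.

End Approximation.

Section Assignments.
Variables (R : realType) (n : nat) (V : nat -> nat -> R).
Implicit Types (g h : seq nat) (acc lev : seq (seq nat)).

(* Coordinate [q] of the profile of an assignment [g] of the first [size g]
   items: the value of bundle [q %% n] for agent [q %/ n]. *)
Definition load (q : nat) g : R :=
  \sum_(l < size g) if nth 0%N g l == (q %% n)%N then V (q %/ n)%N l else 0.

Lemma load_nil q : load q [::] = 0.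
Proof. by rewrite /load big_ord0. Qed.

Lemma load_rcons q g a :
  load q (rcons g a) =
  load q g + if a == (q %% n)%N then V (q %/ n)%N (size g) else 0.
Proof.
rewrite /load size_rcons big_ord_recr/=; congr (_ + _).
  by apply: eq_bigr => l _; rewrite nth_rcons ltn_ord.
by rewrite nth_rcons ltnn eqxx.
Qed.

(** Squares replace the absolute values of [within], since the program can only multiply and
    compare; hence the parameter is the square of the trimming ratio. *)
Definition close (rr : R) g h :=
  all (fun q => (load q g * load q g <= rr * (load q h * load q h))
             && (load q h * load q h <= rr * (load q g * load q g)))
      (iota 0 (n * n)).

Lemma closeP r g h : 0 <= r ->
  reflect (forall q, (q < n * n)%N -> within r (load q g) (load q h))
          (close (r * r) g h).
Proof.
move=> r0; have sq x y : (x * x <= r * r * (y * y)) = (`|x| <= r * `|y|).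
  rewrite -[RHS](ler_pXn2r (n := 2))// ?nnegrE ?mulr_ge0//.
  by rewrite exprMn !real_normK ?num_real// !expr2.
apply: (iffP allP) => [H q hq|H q].
  by have := H q; rewrite mem_iota add0n !sq; apply.
by rewrite mem_iota add0n !sq => /andP[_] /H.
Qed.

Variable rr : R.

Definition trim acc g :=
  if has (fun h => close rr h g) acc then acc else rcons acc g.

Definition trims := foldl trim [::].

Definition extend lev := [seq rcons g a | g <- lev, a <- iota 0 n].

Fixpoint level j := if j is j'.+1 then trims (extend (level j')) else [:: [::]].

Lemma trims_rcons s g : trims (rcons s g) = trim (trims s) g.
Proof. by rewrite /trims foldl_rcons. Qed.

Lemma mem_trims s : {subset trims s <= s}.
Proof.
elim/last_ind: s => [//|s g IH] h; rewrite trims_rcons /trim.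
rewrite mem_rcons inE; case: ifP => _; first by move=> /IH ->; rewrite orbT.
by rewrite mem_rcons inE => /predU1P[->|/IH ->]; rewrite ?eqxx ?orbT.
Qed.

Lemma trims_cover s g : close rr g g -> g \in s ->
  exists2 h, h \in trims s & close rr h g.
Proof.
move=> gg; elim/last_ind: s => [//|s h IH]; rewrite mem_rcons inE trims_rcons.
rewrite /trim => /predU1P[<-|/IH [k ks kg]].
  case: ifPn => [/hasP//|_]; exists g => //.
  by rewrite mem_rcons inE eqxx.
by exists k => //; case: ifP => // _; rewrite mem_rcons inE ks orbT.
Qed.

Definition spread_out := pairwise (fun g h => ~~ close rr g h).

Lemma trims_spread_out s : spread_out (trims s).
Proof.
elim/last_ind: s => [//|s h IH]; rewrite trims_rcons /trim.
case: ifPn => // /hasPn far; rewrite /spread_out pairwise_rcons -/spread_out IH.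
by rewrite andbT; apply/allP.
Qed.

Lemma level_size j g : g \in level j -> size g = j.
Proof.
elim: j g => [|j IH] g /=; first by rewrite inE => /eqP ->.
by move=> /mem_trims /allpairsP[[h a]/= [/IH hj _ ->]]; rewrite size_rcons hj.
Qed.

Lemma level_agents j g : g \in level j -> all (fun a => a < n)%N g.
Proof.
elim: j g => [|j IH] g /=; first by rewrite inE => /eqP ->.
move=> /mem_trims /allpairsP[[h a]/= [/IH hj an ->]].
by rewrite all_rcons hj andbT; move: an; rewrite mem_iota add0n.
Qed.

Lemma level_spread_out j : spread_out (level j).
Proof. by case: j => [|j]; [rewrite /spread_out /=|exact: trims_spread_out]. Qed.

End Assignments.

(** * Every assignment is represented in the trimmed list *)

Section Coverage.
Variables (R : realType) (n : nat) (V : nat -> nat -> R) (r : R).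
Hypothesis r1 : 1 <= r.
Hypothesis V_sign :
  (forall i j, 0 <= V i j) \/ (forall i j, V i j <= 0).
Implicit Types g h : seq nat.

Local Notation load := (load n V).

Let r0 : 0 <= r. Proof. exact: le_trans r1. Qed.

Lemma close_refl g : close n V (r * r) g g.
Proof. by apply/closeP => // q _; apply: within_refl. Qed.

Lemma load_ge0 q g : (forall i j, 0 <= V i j) -> 0 <= load q g.
Proof. by move=> H; apply: sumr_ge0 => l _; case: ifP. Qed.

Lemma load_le0 q g : (forall i j, V i j <= 0) -> load q g <= 0.
Proof. by move=> H; apply: sumr_le0 => l _; case: ifP. Qed.

Lemma load_same q g q' h : same_sign (load q g) (load q' h).
Proof.
rewrite /same_sign; case: V_sign => H; first by rewrite !load_ge0.
by rewrite !(load_le0 _ _ H) orbT.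
Qed.

Lemma load_step_same q g (b : bool) i j :
  same_sign (load q g) (if b then V i j else 0).
Proof.
rewrite /same_sign; case: V_sign => H.
  by rewrite load_ge0//; case: b; rewrite ?H ?lexx.
by rewrite (load_le0 _ _ H); case: b; rewrite ?H ?lexx orbT.
Qed.

(** The representative of a prefix is extended by the same agent, which costs nothing by [withinD];
    trimming the extension then costs one factor [r] per item. *)
Lemma level_cover g : all (fun a => a < n)%N g ->
  exists2 h, h \in level n V (r * r) (size g) &
    forall q, (q < n * n)%N -> within (r ^+ size g) (load q h) (load q g).
Proof.
elim/last_ind: g => [|g a IH].
  by exists [::] => // q _; rewrite expr0 within_refl.
rewrite all_rcons => /andP[an /IH [h hlev hg]]; rewrite size_rcons/=.
have hs := level_size hlev.
have /(trims_cover (close_refl _))[k kt kh] :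
    rcons h a \in extend n (level n V (r * r) (size g)).
  by apply: allpairs_f => //; rewrite mem_iota.
exists k => // q qn; rewrite exprS.
apply: (within_trans (y := load q (rcons h a))) => //; first exact: exprn_ge0.
  by move: q qn; exact: (closeP _ _ _ _ r0 kh).
rewrite !load_rcons hs; apply: withinD (hg _ qn).
- exact: exprn_ege1.
- exact: load_step_same.
- exact: load_step_same.
Qed.

End Coverage.

(** * Counting the assignments that survive trimming *)

Section Counting.
Variables (R : realType) (n : nat) (V : nat -> nat -> R) (r : R) (m : nat).
Hypothesis r1 : 1 < r.
Hypothesis V_sign :
  (forall i j, 0 <= V i j) \/ (forall i j, V i j <= 0).
Implicit Types g h : seq nat.

Local Notation load := (load n V).

(** Averaging: the absolute value of the load is a sum of at most [m] absolute item values, so the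
    largest of them is at least a fraction [1/m] of it. *)
Lemma load_pivot q g : (size g <= m)%N -> load q g != 0 ->
  exists l : 'I_m, (0 < `|V (q %/ n)%N l|) &&
    (`|V (q %/ n)%N l| <= `|load q g| <= m%:R * `|V (q %/ n)%N l|).
Proof.
move=> gm gN0.
pose w l := if nth 0%N g l == (q %% n)%N then `|V (q %/ n)%N l| else 0.
have w0 l : 0 <= w l by rewrite /w; case: ifP.
have xE : `|load q g| = \sum_(l < size g) w l.
  rewrite /load; case: V_sign => H.
    rewrite ger0_norm; last exact: load_ge0.
    by apply: eq_bigr => l _; rewrite /w ger0_norm.
  rewrite ler0_norm; last exact: load_le0.
  rewrite -sumrN; apply: eq_bigr => l _; rewrite /w ler0_norm//.
  by case: ifP => //; rewrite oppr0.
have x0 : 0 < `|load q g| by rewrite normr_gt0.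
have [l xl] : exists l : 'I_(size g), `|load q g| <= m%:R * w l.
  apply/existsP; apply: contraT; rewrite negb_exists => /forallP small.
  have g0 : (0 < size g)%N.
    by rewrite lt0n size_eq0; apply: contraNneq gN0 => ->; rewrite load_nil.
  have : \sum_(l < size g) m%:R * w l < \sum_(l < size g) `|load q g|.
    apply: ltr_sum => [|l _]; first by apply/hasP; exists (Ordinal g0); rewrite ?mem_index_enum.
    by rewrite ltNge small.
  rewrite -mulr_sumr -xE sumr_const card_ord -[X in _ < X]mulr_natl ltr_pM2r//.
  by rewrite ltr_nat ltnNge gm.
have wl : w l = `|V (q %/ n)%N l|.
  move: xl; rewrite /w; case: ifP => // _; rewrite mulr0 => x0'.
  by move: x0; rewrite ltNge x0'.
exists (widen_ord gm l); rewrite /= -wl xl andbT.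
apply/andP; split; last by rewrite xE (bigD1 l)//= lerDl sumr_ge0.
rewrite lt_neqAle w0 andbT eq_sym; apply: contraTneq xl => ->.
by rewrite mulr0 -ltNge.
Qed.

Definition mesh : nat := Num.truncn (m%:R / (r - 1)).

(* A nonzero load is located by an item whose value it exceeds by a factor
   of at most [m], and by rounding it down to a multiple of [r - 1] times that
   value; two loads in the same cell are within a factor [r]. *)
Definition cell (q : nat) g : option ('I_m * 'I_mesh.+1) :=
  if [pick l : 'I_m | (0 < `|V (q %/ n)%N l|) &&
       (`|V (q %/ n)%N l| <= `|load q g| <= m%:R * `|V (q %/ n)%N l|)] is Some l
  then Some (l, inord (Num.truncn (`|load q g| / (`|V (q %/ n)%N l| * (r - 1)))))
  else None.

Lemma truncn_close (x y : R) :
  0 <= x -> 0 <= y -> Num.truncn x = Num.truncn y -> y <= x + 1.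
Proof.
move=> x0 y0 xy; have /andP[_ yS] := truncn_itv y0.
have /andP[xt _] := truncn_itv x0; rewrite -xy -natr1 in yS.
by apply: ltW; apply: lt_le_trans yS _; rewrite lerD2r.
Qed.

(** Equal cells have the same pivot item, worth [w] in absolute value, and the loads differ by at
    most [w * (r - 1)]. As [w] is at most either load in absolute value, this is a relative error of
    at most [r - 1]. *)
Lemma cell_within q g h : (size g <= m)%N -> (size h <= m)%N ->
  cell q g = cell q h -> within r (load q g) (load q h).
Proof.
move=> gm hm; rewrite /cell.
have d0 : 0 < r - 1 by rewrite subr_gt0.
case: pickP => [l /and3P[l0 lg gl]|none]; last first.
  case: pickP => [//|none'] _.
  have -> : load q g = 0.
    by apply/eqP/negPn/negP => /(load_pivot gm)[l]; rewrite none.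
  have -> : load q h = 0.
    by apply/eqP/negPn/negP => /(load_pivot hm)[l]; rewrite none'.
  by apply: within_refl; exact: ltW.
case: pickP => [l' /and3P[l'0 lh hl]|//] [] ll'; subst l' => /(congr1 val).
set w := `|V _ l| in l0 lg gl lh hl *.
have wd : 0 < w * (r - 1) by rewrite mulr_gt0.
(* The index fits below [mesh.+1], so [inord] does not send different multiples to the same
   default. *)
have lt k : `|load q k| <= m%:R * w ->
    (Num.truncn (`|load q k| / (w * (r - 1))) < mesh.+1)%N.
  move=> kw; rewrite ltnS /mesh le_truncn// ler_pdivrMr// mulrACA.
  by rewrite mulVf ?gt_eqF// mulr1.
rewrite /= !inordK ?lt// => E.
have E1 := truncn_close (divr_ge0 (normr_ge0 _) (ltW wd))
                        (divr_ge0 (normr_ge0 _) (ltW wd)) E.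
have E2 := truncn_close (divr_ge0 (normr_ge0 _) (ltW wd))
                        (divr_ge0 (normr_ge0 _) (ltW wd)) (esym E).
move: E1 E2; rewrite !ler_pdivrMr// !mulrDl !divfK ?gt_eqF// !mul1r.
rewrite /within => E1 E2.
have wg : w * (r - 1) <= `|load q g| * (r - 1) by rewrite ler_pM2r.
have wh : w * (r - 1) <= `|load q h| * (r - 1) by rewrite ler_pM2r.
by apply/andP; split; lra.
Qed.

(** A coordinate has [m * mesh.+1] cells for nonzero loads and the cell [None] for 0. *)
Definition level_bound : nat := ((m * mesh.+1).+1 ^ (n * n))%N.

Lemma spread_out_size (s : seq (seq nat)) :
  {in s, forall g, (size g <= m)%N} -> spread_out n V (r * r) s ->
  (size s <= level_bound)%N.
Proof.
move=> sm sep.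
pose cells g := [ffun q : 'I_(n * n) => cell q g].
have : uniq (map cells s).
  rewrite uniq_pairwise pairwise_map.
  apply: (sub_in_pairwise (P := mem s)) sep; last exact/allP.
  move=> g h gs hs /= far; apply: contra far => /eqP /ffunP E.
  apply/closeP => [|q qn]; first by rewrite (le_trans ler01)// ltW.
  apply: cell_within; rewrite ?sm//.
  by have := E (Ordinal qn); rewrite !ffunE.
move=> /card_uniqP; rewrite size_map => <-.
rewrite /level_bound (leq_trans (max_card _))// card_ffun card_option.
by rewrite card_prod !card_ord.
Qed.

End Counting.

(** * Goods and chores together *)

Section Shrink.
Variable R : realType.
Implicit Types (c d x y : R).

(* For [1 <= c] this moves goods towards 0 and chores away from 0. An [alpha]-MMS
   guarantee is the case [c = alpha^-1], an improvement by [1 + gam] the case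
   [c = (1 + gam)^-1]. *)
Definition shrink c x := if 0 <= x then x / c else c * x.

Lemma shrink1 x : shrink 1 x = x.
Proof. by rewrite /shrink divr1 mul1r; case: ifP. Qed.

Lemma shrink_ge0 c x : 0 < c -> (0 <= shrink c x) = (0 <= x).
Proof.
move=> c0; rewrite /shrink; case: ifPn => x0; first by rewrite divr_ge0// ltW.
by rewrite pmulr_rge0// (negbTE x0).
Qed.

Lemma shrink_shrink c d x : 0 < c -> 0 < d ->
  shrink c (shrink d x) = shrink (c * d) x.
Proof.
move=> c0 d0; rewrite [LHS]/shrink shrink_ge0// /shrink.
by case: (0 <= x); rewrite ?mulrA// invfM mulrA mulrAC.
Qed.

Lemma le_shrink c : 0 < c -> {homo shrink c : x y / x <= y}.
Proof.
move=> c0 x y xy; have ci : 0 <= c^-1 by rewrite invr_ge0 ltW.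
rewrite /shrink; case: ifPn => x0; case: ifPn => y0.
- by rewrite ler_wpM2r.
- by move: y0; rewrite (le_trans x0 xy).
- by apply: le_trans (mulr_ge0 y0 ci); rewrite pmulr_rle0// ltW// ltNge.
- by rewrite ler_pM2l.
Qed.

Lemma lt_shrink c : 0 < c -> {homo shrink c : x y / x < y}.
Proof.
move=> c0 x y xy; have ci : 0 < c^-1 by rewrite invr_gt0.
rewrite /shrink; case: ifPn => x0; case: ifPn => y0.
- by rewrite ltr_pM2r.
- by move: y0; rewrite (le_trans x0 (ltW xy)).
- by apply: lt_le_trans (mulr_ge0 y0 (ltW ci)); rewrite pmulr_rlt0// ltNge.
- by rewrite ltr_pM2l.
Qed.

Lemma shrink_le c d x : 0 < c -> c <= d -> shrink d x <= shrink c x.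
Proof.
move=> c0 cd; have d0 := lt_le_trans c0 cd.
rewrite /shrink; case: ifPn => x0; first by rewrite ler_wpM2l// lef_pV2.
by rewrite ler_wnM2r// ltW// ltNge.
Qed.

(** Of the two inequalities in [within], goods use the one bounding [y] and chores the one bounding
    [x]. *)
Lemma within_shrink c x y :
  0 < c -> same_sign x y -> within c x y -> shrink c y <= x.
Proof.
move=> c0 /orP[]/andP[x0 y0] /andP[].
  by rewrite !ger0_norm// => _ yx; rewrite /shrink y0 ler_pdivrMr// mulrC.
rewrite !ler0_norm// !mulrN !lerN2 => cxy _; rewrite /shrink; case: ifP => // y0'.
have y00 : y = 0 by apply/eqP; rewrite eq_le y0.
by move: cxy; rewrite y00 mulr0 mul0r.
Qed.

End Shrink.

Section Score.
Variables (R : realType) (M x : nat -> R).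

(* If [M i] and [x i] have the same sign, this is the largest [t <= 1] such that
   [shrink t^-1 (M i) <= x i] for all [i < k]. *)
Fixpoint score k : R :=
  if k is i.+1 then
    if M i <= x i then score i
    else let t := if 0 <= x i then x i / M i else M i / x i in
      if score i <= t then score i else t
  else 1.

Lemma score_le1 k : score k <= 1.
Proof.
elim: k => //= k IH; case: ifP => // _; case: (boolP (score k <= _)) => //.
by rewrite -ltNge => /ltW /le_trans ->.
Qed.

Lemma score_ge0 k : (forall i, (i < k)%N -> same_sign (M i) (x i)) ->
  0 <= score k.
Proof.
elim: k => //= k IH ss; have s0 := IH (fun i ik => ss i (ltnW ik)).
case: ifPn => // Mx; case: ifP => // _; have := ss k (ltnSn k).
rewrite /same_sign; case: ifPn => x0.
  by case/orP => /andP[M0 x1]; rewrite ?divr_ge0//; move: Mx; rewrite (le_trans M0).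
by case/orP => /andP[M0] // x1; rewrite mulr_le0// invr_le0.
Qed.

Lemma shrinkV_le (t a b : R) : same_sign a b -> 0 < t <= 1 ->
  (shrink t^-1 a <= b) =
  (a <= b) || (t <= if 0 <= b then b / a else a / b).
Proof.
move=> ab /andP[t0 t1].
have sa : shrink t^-1 a <= a.
  by rewrite -[leRHS]shrink1; apply: shrink_le => //; rewrite invf_ge1.
case: (leP a b) => [/(le_trans sa) -> //|ba] /=.
rewrite /shrink; case/orP: ab => /andP[a0 b0].
  by rewrite a0 b0 invrK ler_pdivlMr 1?mulrC// (le_lt_trans b0).
have b1 : b < 0 by exact: lt_le_trans ba a0.
rewrite [0 <= b]leNgt b1/= ler_ndivlMr//.
have [a1|a1] := leP 0 a.
  have -> : a = 0 by apply/eqP; rewrite eq_le a0.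
  by rewrite mul0r !leNgt pmulr_rlt0// b1.
by rewrite /= ler_pdivrMl.
Qed.

(** Positivity of [t] matters: the score is 0 when some agent with a positive [M i] gets nothing of
    value, and then no guarantee can be read off it. *)
Lemma le_scoreP k t : (forall i, (i < k)%N -> same_sign (M i) (x i)) ->
  0 < t <= 1 ->
  reflect (forall i, (i < k)%N -> shrink t^-1 (M i) <= x i) (t <= score k).
Proof.
move=> + t01; elim: k => [|k IH] ss.
  by case/andP: t01 => _ /= ->; constructor.
have {}IH := IH (fun i ik => ss i (ltnW ik)).
have -> : (t <= score k.+1) = (t <= score k) && (shrink t^-1 (M k) <= x k).
  rewrite (shrinkV_le (ss k (ltnSn k)) t01)/=; case: (leP (M k) (x k)) => _ /=.
    by rewrite andbT.
  case: (leP (score k)) => su; apply/idP/andP => [H|[]//]; split => //.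
    exact: le_trans H su.
  exact: le_trans H (ltW su).
apply: (iffP andP) => [[/IH H Hk] i|H].
  by rewrite ltnS leq_eqVlt => /predU1P[->|/H].
by split; [apply/IH => i ik; apply: H; exact: ltnW|exact: H].
Qed.

End Score.

(** * Lists of agents as allocations *)

Section AllocationOf.
Variables (R : realType) (n m : nat) (v : 'I_n -> 'I_m -> R).
Variable V : nat -> nat -> R.
Hypothesis VE : forall (i : 'I_n) (j : 'I_m), V i j = v i j.
Implicit Types g : seq nat.
Local Notation alloc := {ffun 'I_n -> {set 'I_m}}.

Definition allocation_of g : alloc :=
  [ffun i : 'I_n => [set j : 'I_m | nth 0%N g j == i :> nat]%SET].

Lemma allocation_ofP g : size g = m -> all (fun a => a < n)%N g ->
  allocation_of g \in allocations n m.
Proof.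
move=> gm /allP gn; rewrite inE; apply/andP; split.
  rewrite finset.eqEsubset finset.subsetT/=; apply/fintype.subsetP => j _.
  have jn : (nth 0%N g j < n)%N by apply: gn; rewrite mem_nth ?gm.
  by apply/finset.bigcupP; exists (Ordinal jn) => //; rewrite ffunE inE.
apply/forallP => k; apply/forallP => l; apply/implyP => kl.
rewrite -finset.setI_eq0 !ffunE; apply/eqP/finset.setP => j; rewrite !inE.
by apply/negP => /andP[/eqP -> /eqP/val_inj kl']; rewrite kl' eqxx in kl.
Qed.

Lemma allocation_of_surj A : A \in allocations n m ->
  exists g, [/\ size g = m, all (fun a => a < n)%N g & allocation_of g = A].
Proof.
rewrite inE => /andP[/eqP cov /forallP dis].
pose o j := [pick i | j \in A i].
have oP j : exists2 i : 'I_n, o j = Some i & j \in A i.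
  rewrite /o; case: pickP => [i ij|none]; first by exists i.
  have : j \in \bigcup_i A i by rewrite cov inE.
  by case/finset.bigcupP => i _; rewrite none.
exists [seq oapp (@nat_of_ord n) 0%N (o j) | j <- enum 'I_m]; split.
- by rewrite size_map size_enum_ord.
- by apply/allP => a /mapP[j _ ->]; have [i ->] := oP j; rewrite /=.
- apply/ffunP => i; apply/finset.setP => j; rewrite ffunE inE.
  rewrite (nth_map j) ?size_enum_ord// nth_ord_enum.
  have [i' -> ji'] /= := oP j; rewrite (inj_eq val_inj).
  apply/eqP/idP => [<-//|ji]; apply/eqP; apply: contraT => ii'.
  have /forallP/(_ i)/implyP/(_ ii') := dis i'.
  by rewrite disjoint_subset => /fintype.subsetP/(_ j ji'); rewrite inE ji.
Qed.

Lemma value_allocation_of g (i k : 'I_n) : size g = m ->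
  value v i (allocation_of g k) = load n V (i * n + k) g.
Proof.
move=> gm; rewrite /value /load ffunE gm big_mkcond/=.
apply: eq_bigr => j _; rewrite inE modnMDl modn_small// divnMDl ?divn_small//.
  by rewrite addn0 VE.
by apply: leq_ltn_trans (ltn_ord k).
Qed.

End AllocationOf.

Section MaxMin.
Variables (R : realType) (n m : nat) (v : 'I_n -> 'I_m -> R).
Hypothesis n0 : (0 < n)%N.
Local Notation alloc := {ffun 'I_n -> {set 'I_m}}.

(* [MMS] is defined through extended reals, but is attained. *)
Lemma MMS_max i :
  (exists2 A, A \in allocations n m & forall k, MMS v i <= value v i (A k)) /\
  (forall A t, A \in allocations n m -> (forall k, t <= value v i (A k)) ->
     t <= MMS v i).
Proof.
pose k0 := Ordinal n0.
pose mn (A : alloc) := \big[mine/+oo%E]_(k < n) (value v i (A k))%:E.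
have mnE A : exists k, mn A = (value v i (A k))%:E.
  by have [k _] := @eq_bigmin _ _ _ +oo%E k0 predT
    (fun k => (value v i (A k))%:E) isT (fun k _ => leey _); exists k.
(* Giving everything to agent 0 shows that the maximum ranges over a nonempty set, so it is
   attained. *)
pose A0 := allocation_of n m (nseq m 0%N).
have A0P : A0 \in allocations n m.
  by apply: allocation_ofP; rewrite ?size_nseq// all_nseq n0 orbT.
have [A1 A1P E1] : {A1 | A1 \in allocations n m &
    \big[maxe/-oo%E]_(A in allocations n m) mn A = mn A1}.
  by apply: (@eq_bigmax _ _ _ -oo%E A0 (mem (allocations n m)) mn) => // A _; exact: leNye.
have [k1 Ek1] := mnE A1.
have MMSE : (MMS v i)%:E = mn A1 by rewrite /MMS -/mn E1 Ek1.
split.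
  exists A1 => // k; rewrite -lee_fin MMSE.
  exact: bigmin_le.
move=> A t AP tA; rewrite -lee_fin MMSE -E1.
apply: (bigmax_sup A) => //; have [k ->] := mnE A.
by rewrite lee_fin; exact: tA.
Qed.

Lemma MMS_shrink alpha A : 0 < alpha ->
  is_MMS v alpha A <-> forall i, shrink alpha^-1 (MMS v i) <= value v i (A i).
Proof.
move=> a0; rewrite /is_MMS /shrink; split => [/(_ a0) H i|H _ i].
  have [H1 H2] := H i; case: ifPn => [M0|]; first by rewrite invrK mulrC H1.
  by rewrite -ltNge => /H2.
have := H i; case: ifPn => [M0 Hi|]; split => // M1.
- by rewrite invrK mulrC in Hi.
- by move: M0; rewrite leNgt M1.
Qed.

Lemma improved_shrink gam A i : 0 < gam ->
  improved v gam A i = shrink (1 + gam)^-1 (value v i (A i)).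
Proof. by move=> g0; rewrite /improved /shrink; case: ifP; rewrite ?invrK// mulrC. Qed.

End MaxMin.

(** * Selecting an assignment from a trimmed list *)

Lemma coord_lt n i k : (i < n)%N -> (k < n)%N -> (i * n + k < n * n)%N.
Proof.
move=> ni nk; have n0 := leq_ltn_trans (leq0n _) ni.
by rewrite -ltn_divLR// divnMDl// divn_small// addn0.
Qed.

Section Selection.
Variables (R : realType) (n m : nat) (v : 'I_n -> 'I_m -> R).
Variable V : nat -> nat -> R.
Hypothesis n0 : (0 < n)%N.
Hypothesis VE : forall (i : 'I_n) (j : 'I_m), V i j = v i j.
Hypothesis V_sign :
  (forall i j, 0 <= V i j) \/ (forall i j, V i j <= 0).
Implicit Types g h : seq nat.

Local Notation load := (load n V).

Definition own g i := load (i * n + i) g.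

Definition welfare g : R := \sum_(i < n) own g i.

Definition better (M : nat -> R) g h :=
  (score M (own h) n < score M (own g) n)
  || (score M (own h) n <= score M (own g) n) && (welfare h < welfare g).

Variables (c : R) (L : seq (seq nat)) (M : nat -> R) (G : seq nat).
Hypothesis c1 : 1 <= c.
Hypothesis L_assign :
  {in L, forall g, size g = m /\ all (fun a => a < n)%N g}.
Hypothesis L_cover : forall g, size g = m -> all (fun a => a < n)%N g ->
  exists2 h, h \in L &
    forall q, (q < n * n)%N -> within c (load q h) (load q g).
Hypothesis M_max : forall i, (i < n)%N ->
  (forall h, h \in L -> exists2 k, (k < n)%N & load (i * n + k) h <= M i) /\
  (exists2 h, h \in L & forall k, (k < n)%N -> M i <= load (i * n + k) h).
Hypothesis GL : G \in L.
Hypothesis G_best : {in L, forall h, ~~ better M h G}.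

Let c0 : 0 < c. Proof. exact: lt_le_trans c1. Qed.

(** [M i] lies between two loads, which all have the sign of the manna. *)
Let M_same i g : (i < n)%N -> same_sign (M i) (own g i).
Proof.
move=> ni; have [ub [h hL lb]] := M_max ni; rewrite /same_sign.
have [k kn Mk] := ub h hL.
case: V_sign => H.
  by rewrite (le_trans _ Mk) ?load_ge0// /own load_ge0.
by rewrite orbC (le_trans (lb 0%N n0)) ?load_le0// /own load_le0.
Qed.

Let cover_shrink g : size g = m -> all (fun a => a < n)%N g ->
  exists2 h, h \in L & forall i k, (i < n)%N -> (k < n)%N ->
    shrink c (load (i * n + k) g) <= load (i * n + k) h.
Proof.
move=> gm gn; have [h hL hg] := L_cover gm gn; exists h => // i k ni nk.
apply: within_shrink => //; first exact: load_same.
exact/hg/coord_lt.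
Qed.

(** Listed assignments are genuine allocations, so the maximum over the list can only fall short. *)
Let M_le_MMS (i : 'I_n) : M i <= MMS v i.
Proof.
have [_ [h hL hM]] := M_max (ltn_ord i); have [hm hn] := L_assign hL.
apply: (proj2 (MMS_max v n0 i) (allocation_of n m h)).
  exact: allocation_ofP.
by move=> k; rewrite (value_allocation_of VE)// hM.
Qed.

(** An allocation attaining the MMS has a representative in the list. *)
Let MMS_le_M (i : 'I_n) : shrink c (MMS v i) <= M i.
Proof.
have [[A AP AM] _] := MMS_max v n0 i.
have [g [gm gn gA]] := allocation_of_surj AP.
have [h hL hg] := cover_shrink gm gn.
have [/(_ h hL)[k kn kM] _] := M_max (ltn_ord i).
apply: le_trans kM; apply: le_trans (hg i k _ kn) => //.
apply: le_shrink => //.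
by rewrite -[k]/(val (Ordinal kn)) -(value_allocation_of VE)// gA; apply: AM.
Qed.

Lemma selection_MMS alpha beta A : 0 < alpha <= 1 -> A \in allocations n m ->
  is_MMS v alpha A -> beta * (c * c) <= alpha ->
  is_MMS v beta (allocation_of n m G).
Proof.
move=> /andP[a0 a1] AP /(MMS_shrink _ _ a0) AM bc.
case: (ltP 0 beta) => b0; last by move=> b1; rewrite leNgt b1 in b0.
apply/(MMS_shrink _ _ b0) => // i.
have [Gm Gn] := L_assign GL.
rewrite (value_allocation_of VE)// -/(own G i).
have [g [gm gn gA]] := allocation_of_surj AP.
have [h hL hg] := cover_shrink gm gn.
(* One factor [c] is lost here, in passing from [A] to its representative [h]. The second one is
   lost at the end, where [M i] is replaced by the true MMS; together they give the hypothesis on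
   [beta]. *)
pose t := alpha / c.
have t01 : 0 < t <= 1.
  by rewrite divr_gt0//= ler_pdivrMr// mul1r (le_trans a1).
have ai : 0 < alpha^-1 by rewrite invr_gt0.
have hs : t <= score M (own h) n.
  apply/le_scoreP => // [k kn|k kn]; first exact: M_same.
  rewrite /t invf_div -shrink_shrink//.
  apply: le_trans (hg k k kn kn); apply: le_shrink => //.
  rewrite -(value_allocation_of VE (Ordinal kn) (Ordinal kn))// gA.
  apply: le_trans (AM _); apply: le_shrink => //.
  exact: (M_le_MMS (Ordinal kn)).
have Gs : t <= score M (own G) n.
  apply: le_trans hs _; have := G_best hL; rewrite /better negb_or -leNgt.
  by case/andP.
have := elimT (le_scoreP (fun k kn => M_same G kn) t01) Gs i (ltn_ord i).
apply: le_trans; have ti : 0 < t^-1 by rewrite invr_gt0; case/andP: t01.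
apply: le_trans (le_shrink ti (MMS_le_M i)).
rewrite shrink_shrink//; apply: shrink_le; first exact: mulr_gt0.
rewrite /t invf_div mulrAC ler_pdivrMr// ler_pdivlMl//.
Qed.

Lemma selection_PO gam : 0 < gam -> c <= 1 + gam ->
  is_PO v gam (allocation_of n m G).
Proof.
move=> g0 cg [B [BP imp [i0 imp0]]].
have [Gm Gn] := L_assign GL.
have [g [gm gn gB]] := allocation_of_surj BP.
have [h hL hg] := cover_shrink gm gn.
have vG (i : 'I_n) : value v i (allocation_of n m G i) = own G i.
  by rewrite (value_allocation_of VE).
have vB (i : 'I_n) : value v i (B i) = own g i.
  by rewrite -gB (value_allocation_of VE).
have d0 : 0 < (1 + gam)^-1 by rewrite invr_gt0; lra.
(* The improvement by [1 + gam] pays for the factor [c] lost by representing [B] in the list. *)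
have own_le (i : 'I_n) : own G i <= shrink c (shrink (1 + gam)^-1 (own G i)).
  rewrite shrink_shrink// -[leLHS]shrink1; apply: shrink_le; first exact: mulr_gt0.
  by rewrite ler_pdivrMr ?mul1r//; lra.
have Gh (i : nat) : (i < n)%N -> own G i <= own h i.
  move=> ni; apply: le_trans (hg i i ni ni).
  apply: le_trans (own_le (Ordinal ni)) _; apply: le_shrink => //.
  by have := imp (Ordinal ni); rewrite improved_shrink// vG vB.
have Gh0 : own G i0 < own h i0.
  apply: lt_le_trans (hg i0 i0 (ltn_ord i0) (ltn_ord i0)).
  apply: le_lt_trans (own_le i0) _; apply: lt_shrink => //.
  by move: imp0; rewrite improved_shrink// vG vB.
suff sGh : score M (own G) n <= score M (own h) n.
  have := G_best hL; rewrite /better sGh /= negb_or /welfare => /andP[_].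
  rewrite (bigD1 i0)//= [ltRHS](bigD1 i0)//= ltr_leD//.
  by apply: ler_sum => i _; apply: Gh.
(* [le_scoreP] applies to positive ratios only; a score of 0 is trivially not lowered. *)
have [s0|s0] := leP (score M (own G) n) 0.
  by apply: le_trans s0 _; apply: score_ge0 => i ni; exact: M_same.
have s01 : 0 < score M (own G) n <= 1 by rewrite s0 score_le1.
apply/le_scoreP => // [i ni|i ni]; first exact: M_same.
apply: le_trans (Gh i ni).
exact: (elimT (le_scoreP (fun k kn => M_same G kn) s01) (lexx _)).
Qed.

End Selection.

(** * Reasoning about programs with time *)

Section Logic.
Variable R : realType.
Implicit Types (c : cmd) (s : store R) (I Q : store R -> Prop).

Fixpoint loopfree c :=
  match c with
  | Skip | ISet _ _ _ | RSet _ _ _ => true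
  | Seq c1 c2 | If _ c1 c2 => loopfree c1 && loopfree c2
  | While _ _ => false
  end.

Fixpoint run c s : store R :=
  match c with
  | ISet a e1 e2 => Store (update (imem s) a (ieval s e1) (ieval s e2)) (rmem s)
  | RSet a e1 e2 => Store (imem s) (update (rmem s) a (ieval s e1) (reval s e2))
  | Seq c1 c2 => run c2 (run c1 s)
  | If b c1 c2 => if beval s b then run c1 s else run c2 s
  | Skip | While _ _ => s
  end.

(** An upper bound that charges both branches of an [If]; the value at [While] is a dummy, excluded
    by [loopfree]. *)
Fixpoint ccost c : nat :=
  match c with
  | Skip | While _ _ => 1
  | ISet _ e1 e2 => (icost e1 + icost e2).+1
  | RSet _ e1 e2 => (icost e1 + rcost e2).+1
  | Seq c1 c2 => (ccost c1 + ccost c2).+1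
  | If b c1 c2 => (bcost b + (ccost c1 + ccost c2)).+1
  end.

Lemma exec_run c s : loopfree c ->
  exists2 t, (t <= ccost c)%N & exec c s t (run c s).
Proof.
elim: c s => //=.
- by move=> s _; exists 1%N => //; constructor.
- by move=> a e1 e2 s _; eexists; last by constructor.
- by move=> a e1 e2 s _; eexists; last by constructor.
- move=> c1 IH1 c2 IH2 s /andP[l1 l2].
  have [t1 H1 E1] := IH1 s l1; have [t2 H2 E2] := IH2 (run c1 s) l2.
  by exists (t1 + t2).+1; [rewrite ltnS leq_add|exact: ExSeq E1 E2].
- move=> b c1 IH1 c2 IH2 s /andP[l1 l2].
  have [t1 H1 E1] := IH1 s l1; have [t2 H2 E2] := IH2 s l2.
  case bs: (beval s b).
    exists (bcost b + t1).+1; last by constructor; rewrite bs.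
    by rewrite ltnS leq_add2l (leq_trans H1)// leq_addr.
  exists (bcost b + t2).+1; last by constructor; rewrite bs.
  by rewrite ltnS leq_add2l (leq_trans H2)// leq_addl.
Qed.

Definition wp c (T : nat) Q s :=
  exists t s', [/\ exec c s t s', (t <= T)%N & Q s'].

Lemma wp_le c (T T' : nat) Q Q' s :
  (T <= T')%N -> (forall s', Q s' -> Q' s') -> wp c T Q s -> wp c T' Q' s.
Proof.
move=> TT QQ [t [s' [E H q]]]; exists t, s'; split=> //; last exact: QQ.
exact: leq_trans TT.
Qed.

Lemma wp_run c Q s : loopfree c -> Q (run c s) -> wp c (ccost c) Q s.
Proof. by move=> /(exec_run s)[t tc E] q; exists t, (run c s). Qed.

Lemma wp_seq c1 c2 T1 T2 Q s :
  wp c1 T1 (wp c2 T2 Q) s -> wp (Seq c1 c2) (T1 + T2).+1 Q s.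
Proof.
move=> [t1 [s1 [E1 H1 [t2 [s2 [E2 H2 q]]]]]]; exists (t1 + t2).+1, s2.
by split=> //; [exact: ExSeq E1 E2|rewrite ltnS leq_add].
Qed.

(** The invariant is indexed by the number of completed iterations, of which there are exactly [N];
    the factor [N.+1] also pays for the last, failing test. *)
Lemma wp_while (I : nat -> store R -> Prop) N T b c s :
  (forall k s, (k < N)%N -> I k s -> beval s b /\ wp c T (I k.+1) s) ->
  (forall s, I N s -> ~~ beval s b) ->
  I 0%N s -> wp (While b c) (N.+1 * (bcost b + T).+1) (I N) s.
Proof.
move=> step stop.
suff H d k s0 : (k + d)%N = N -> I k s0 ->
    wp (While b c) (d.+1 * (bcost b + T).+1) (I N) s0.
  by move=> I0; apply: (H N 0%N).
elim: d k s0 => [|d IH] k s0 kd Ik.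
  rewrite addn0 in kd; subst k; exists (bcost b).+1, s0.
  by split=> //; [constructor; exact: stop|rewrite mul1n ltnS leq_addr].
have kN : (k < N)%N by rewrite -kd addnS ltnS leq_addr.
have [bs [t1 [s1 [E1 H1 I1]]]] := step _ _ kN Ik.
have [|t2 [s2 [E2 H2 I2]]] := IH k.+1 s1 _ I1; first by rewrite addSn -addnS.
exists (bcost b + t1 + t2).+1, s2; split=> //; first exact: ExWhileStep E1 E2.
by rewrite mulSn -addSn leq_add// ltnS leq_add2l.
Qed.

(** Array numbers are literals of the language, so a loop over agents or profile coordinates must be
    unrolled in the program text. This is possible as [n] is a constant. *)
Fixpoint seqs k (f : nat -> cmd) : cmd :=
  if k is k'.+1 then Seq (seqs k' f) (f k') else Skip.

Lemma loopfree_seqs k f : (forall i, loopfree (f i)) -> loopfree (seqs k f).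
Proof. by move=> lf; elim: k => //= k ->; rewrite lf. Qed.

Lemma wp_seqs (I : nat -> store R -> Prop) k T f s :
  (forall i s, (i < k)%N -> I i s -> wp (f i) T (I i.+1) s) ->
  I 0%N s -> wp (seqs k f) (k * T.+1).+1 (I k) s.
Proof.
move=> step I0; elim: k step => [|k IH] step.
  by exists 1%N, s; split=> //; constructor.
have W : wp (seqs k.+1 f) ((k * T.+1).+1 + T).+1 (I k.+1) s.
  apply: wp_seq; apply: wp_le (leqnn _) _ (IH _) => [s'|i s' ik]; apply: step => //.
  exact: ltnW.
by apply: wp_le W => //; rewrite mulSn; lia.
Qed.

Fixpoint bands k (f : nat -> bexp) : bexp :=
  if k is k'.+1 then BAnd (bands k' f) (f k') else ILe (ILit 0) (ILit 0).

Lemma beval_bands s k f :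
  beval s (bands k f) = all (fun q => beval s (f q)) (iota 0 k).
Proof. by elim: k => // k IH; rewrite -[in RHS]addn1 iotaD all_cat -IH /= andbT. Qed.

End Logic.

(** * Building the lists *)

(* Cells of integer array 0: the number of items, the current item, the current
   entry, the bounds of the current level, the number of entries, the entry
   searched, the best entry. Integer arrays 2 and 3 hold the parent of an entry
   and the agent who gets its last item, real array [n.+1 + q] its load [q]. Cells
   2, 3, 4 and [10 + i] of real array 0: the number of items plus 1, the squared
   trimming ratio, a minimum being computed, the approximate MMS of agent [i]. *)
Local Notation pM := (IGet 0 (ILit 0)).
Local Notation pJ := (IGet 0 (ILit 1)).
Local Notation pE := (IGet 0 (ILit 2)).
Local Notation pLO := (IGet 0 (ILit 3)).
Local Notation pHI := (IGet 0 (ILit 4)).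
Local Notation pLEN := (IGet 0 (ILit 5)).
Local Notation pF := (IGet 0 (ILit 6)).
Local Notation pB := (IGet 0 (ILit 7)).
Local Notation iset k e := (ISet 0 (ILit k) e).
Local Notation inc k := (ISet 0 (ILit k) (IAdd (IGet 0 (ILit k)) (ILit 1))).
Local Notation rv k := (RGet 0 (ILit k)).
Local Notation rset k e := (RSet 0 (ILit k) e).
Local Notation ILt e1 e2 := (BNot (ILe e2 e1)).
Local Notation RLt e1 e2 := (BNot (RLe e2 e1)).

Section Program.
Variable n : nat.

Local Notation load_at q e := (RGet (n.+1 + q) e).

Definition fill a : cmd :=
  seqs (n * n) (fun q => RSet (n.+1 + q) pLEN
    (if a == (q %% n)%N then RAdd (load_at q pE) (RGet (q %/ n).+1 pJ)
     else load_at q pE)).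

(** The candidate is written just past the end of the list and becomes an entry only if the length
    is raised; otherwise the next proposal overwrites it. The search starts at [pHI], where the new
    level begins. *)
Definition propose a : cmd :=
  Seq (fill a) (Seq (ISet 2 pLEN pE) (Seq (ISet 3 pLEN (ILit a)) (iset 6 pHI))).

Definition close_test : bexp :=
  bands (n * n) (fun q =>
    BAnd (RLe (RMul (load_at q pF) (load_at q pF))
              (RMul (rv 3) (RMul (load_at q pLEN) (load_at q pLEN))))
         (RLe (RMul (load_at q pLEN) (load_at q pLEN))
              (RMul (rv 3) (RMul (load_at q pF) (load_at q pF))))).

(* The search stops at the proposed entry at the latest. *)
Definition try_agent a : cmd :=
  Seq (propose a)
    (Seq (While (BNot close_test) (inc 6)) (If (ILe pLEN pF) (inc 5) Skip)).

Definition next_level : cmd :=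
  Seq (iset 2 pLO)
    (Seq (While (ILt pE pHI) (Seq (seqs n try_agent) (inc 2)))
       (Seq (iset 3 pHI) (Seq (iset 4 pLEN) (inc 1)))).

Definition build : cmd := While (ILt pJ pM) next_level.

Variables (R : realType) (m : nat) (V : nat -> nat -> R) (rr : R).
Implicit Types (s : store R) (L acc lev : seq (seq nat)) (g : seq nat).

Local Notation load := (load n V).

Record represents s L : Prop := Represents {
  rep_items : imem s 0 0 = m;
  rep_ratio : rmem s 0 3 = rr;
  rep_values : forall i j, (i < n)%N -> rmem s i.+1 j = V i j;
  rep_size : imem s 0 5 = size L;
  rep_load : forall e q, (e < size L)%N -> (q < n * n)%N ->
    rmem s (n.+1 + q) e = load q (nth [::] L e);
  rep_parent : forall e, (e < size L)%N -> nth [::] L e = [::] \/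
    ((imem s 2 e < size L)%N /\
     nth [::] L e = rcons (nth [::] L (imem s 2 e)) (imem s 3 e)) }.

Definition stepped s (a b : nat) : R :=
  let q := (b - n.+1)%N in
  if a == (q %% n)%N then
    rmem s b (imem s 0 2) + rmem s (q %/ n).+1 (imem s 0 1)
  else rmem s b (imem s 0 2).

(** The slot written differs from the entry read, and the valuations sit in arrays numbered at most
    [n], so the unrolled assignments do not disturb each other's operands. *)
Lemma run_fill s a : imem s 0 2 != imem s 0 5 ->
  imem (run (fill a) s) = imem s /\
  forall b l, rmem (run (fill a) s) b l =
    if (n < b <= n + n * n)%N && (l == imem s 0 5) then stepped s a b
    else rmem s b l.
Proof.
move=> eN; rewrite /fill; set f := fun q => _.
suff H k : (k <= n * n)%N -> imem (run (seqs k f) s) = imem s /\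
  forall b l, rmem (run (seqs k f) s) b l =
    if (n < b <= n + k)%N && (l == imem s 0 5) then stepped s a b
    else rmem s b l by exact: H.
elim: k => [_|k IH kn].
  split=> // b l; rewrite addn0; case: ifP => // /andP[/andP[nb bn]].
  by rewrite ltnNge bn in nb.
have [IH1 IH2] := IH (ltnW kn); rewrite /= {2}/f; set s1 := run _ s in IH1 IH2 *.
split=> // b l; rewrite /= /update IH1.
have kd : (k %/ n < n)%N by rewrite ltn_divLR; case: (n) kn => //; rewrite muln0.
case: (eqVneq b (n.+1 + k)%N) => [->|bk] /=; last first.
  rewrite IH2; congr (if _ && _ then _ else _).
  by move/eqP: bk; lia.
have -> : (n < n.+1 + k <= n + k.+1)%N by lia.
case: (eqVneq l (imem s 0 5)) => [->|lk] /=; last first.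
  by rewrite IH2 (negbTE lk) andbF.
rewrite /stepped (_ : (n.+1 + k - n.+1 = k)%N); last lia.
case: ifP => _ /=; rewrite ?IH1 !IH2 (negbTE eN) !andbF//.
by rewrite (_ : (n < (k %/ n).+1)%N = false)//; apply/negbTE; rewrite -leqNgt.
Qed.

Lemma run_propose s a : imem s 0 2 != imem s 0 5 ->
  let s1 := run (propose a) s in
  [/\ imem s1 0 6 = imem s 0 4,
      forall k, k != 6%N -> imem s1 0 k = imem s 0 k,
      forall e, imem s1 2 e = if e == imem s 0 5 then imem s 0 2 else imem s 2 e,
      forall e, imem s1 3 e = if e == imem s 0 5 then a else imem s 3 e
    & forall b l, rmem s1 b l =
        if (n < b <= n + n * n)%N && (l == imem s 0 5) then stepped s a b
        else rmem s b l].
Proof.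
move=> eN; have [H1 H2] := run_fill a eN.
rewrite /propose /= /update /= !H1; split=> //.
by move=> k /negbTE ->.
Qed.

Hypothesis rr_refl : forall g, close n V rr g g.

Lemma close_testE s L1 acc g :
  (forall e q, (e < size (L1 ++ rcons acc g))%N -> (q < n * n)%N ->
     rmem s (n.+1 + q) e = load q (nth [::] (L1 ++ rcons acc g) e)) ->
  rmem s 0 3 = rr -> imem s 0 5 = (size L1 + size acc)%N ->
  forall p, (p <= size acc)%N -> imem s 0 6 = (size L1 + p)%N ->
  beval s close_test = close n V rr (nth [::] (rcons acc g) p) g.
Proof.
move=> ld rrE len p pa sF; rewrite beval_bands /close.
apply: eq_in_all => q; rewrite mem_iota => /andP[_ qn] /=.
have E1 : rmem s (n.+1 + q) (imem s 0 6) = load q (nth [::] (rcons acc g) p).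
  rewrite sF ld// ?size_cat ?size_rcons ?ltn_add2l//.
  by rewrite nth_cat ltnNge leq_addr/= addKn.
have E2 : rmem s (n.+1 + q) (imem s 0 5) = load q g.
  rewrite len ld// ?size_cat ?size_rcons ?ltn_add2l//.
  by rewrite nth_cat ltnNge leq_addr/= addKn nth_rcons ltnn eqxx.
by rewrite E1 E2 rrE.
Qed.

Definition try_cost a N :=
  (ccost (propose a) + (N.+1 * (bcost (BNot close_test) + ccost (inc 6)).+1
     + ccost (If (ILe pLEN pF) (inc 5) Skip)).+1).+1.

Lemma try_agent_wp a N s L1 acc :
  represents s (L1 ++ acc) -> imem s 0 4 = size L1 ->
  (imem s 0 2 < size L1)%N ->
  imem s 0 1 = size (nth [::] L1 (imem s 0 2)) -> (size acc <= N)%N ->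
  wp (try_agent a) (try_cost a N)
    (fun s' => represents s'
         (L1 ++ trim n V rr acc (rcons (nth [::] L1 (imem s 0 2)) a))
       /\ forall k, (k < 5)%N -> imem s' 0 k = imem s 0 k) s.
Proof.
move=> rep hi eL jE aN; set e := imem s 0 2 in eL jE *.
set g := rcons _ a.
have [rm rrE rV rlen rld rpar] := rep.
have lenE : imem s 0 5 = (size L1 + size acc)%N by rewrite rlen size_cat.
have eN : imem s 0 2 != imem s 0 5 by rewrite -/e lenE; lia.
have lf : loopfree (propose a) by rewrite /= loopfree_seqs.
apply: wp_seq; apply: (wp_run lf).
have [p6 pk p2 p3 pr] := run_propose a eN; set s1 := run _ s in p6 pk p2 p3 pr *; clearbody s1.
have nthL d : (d < size L1 + size acc)%N ->
    nth [::] (L1 ++ rcons acc g) d = nth [::] (L1 ++ acc) d.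
  move=> dl; rewrite -cats1 catA nth_cat size_cat.
  by rewrite dl.
have nthg : nth [::] (L1 ++ rcons acc g) (size L1 + size acc) = g.
  by rewrite nth_cat ltnNge leq_addr/= addKn nth_rcons ltnn eqxx.
have nthe : nth [::] (L1 ++ rcons acc g) e = nth [::] L1 e by rewrite nth_cat eL.
have ld1 d q : (d < size (L1 ++ rcons acc g))%N -> (q < n * n)%N ->
    rmem s1 (n.+1 + q) d = load q (nth [::] (L1 ++ rcons acc g) d).
  rewrite size_cat size_rcons addnS ltnS leq_eqVlt => dl qn; rewrite pr lenE.
  have -> : (n < n.+1 + q <= n + n * n)%N by lia.
  case: eqP dl => [-> _|_ /= dl] /=; last by rewrite rld ?size_cat// nthL.
  have qd : (q %/ n < n)%N by rewrite ltn_divLR//; case: (n) qn => //; rewrite muln0.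
  rewrite /stepped addKn nthg load_rcons -/e rld ?size_cat ?ltn_addr// nth_cat eL.
  by case: ifP; rewrite ?addr0// rV// jE.
(* The number of search steps is thus known in advance: it leads to the first kept assignment close
   to [g], or, if there is none, to the slot of [g] itself, which stops the loop by [rr_refl]. *)
pose p := find (fun h => close n V rr h g) acc.
have pa : (p <= size acc)%N by exact: find_size.
pose I k s2 := [/\ imem s2 0 6 = (size L1 + k)%N,
  forall b l, (b != 0%N) || (l != 6%N) -> imem s2 b l = imem s1 b l
  & rmem s2 = rmem s1].
have testE k s2 : (k <= p)%N -> I k s2 ->
    beval s2 close_test = close n V rr (nth [::] (rcons acc g) k) g.
  move=> kp [i6 im rm2]; apply: (close_testE (L1 := L1)) => //.
  - by move=> d q dl qn; rewrite rm2 ld1.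
  - by rewrite rm2 pr.
  - by rewrite im// pk// lenE.
  - exact: leq_trans kp pa.
have W : wp (While (BNot close_test) (inc 6))
    (p.+1 * (bcost (BNot close_test) + ccost (inc 6)).+1) (I p) s1.
  apply: wp_while => [k s2 kp Ik|s2 Ip|]; last first.
  - by split=> //; rewrite p6 hi addn0.
  - rewrite /= (testE p)// negbK.
    have := pa; rewrite leq_eqVlt => /predU1P[->|plt].
      by rewrite nth_rcons ltnn eqxx.
    by rewrite nth_rcons plt; have := plt; rewrite -has_find => /(nth_find [::]).
  rewrite /= (testE k)//; last exact: ltnW.
  have ka := leq_trans kp pa.
  rewrite nth_rcons ka (before_find [::] kp); split=> //.
  have [i6 im rm2] := Ik; apply: wp_run => //; split=> //=.
  + by rewrite /update /= i6 addn1 addnS.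
  + by move=> b l bl; rewrite /update -(im b l bl); case: ifP bl => // /andP[/eqP -> /eqP ->].
apply: wp_seq; apply: wp_le W => [|s2 [i6 im rm2]].
  by rewrite leq_mul2r ltnS (leq_trans pa aN) orbT.
apply: wp_run => //; rewrite /= im// pk// i6 lenE leq_add2l.
have frame k : (k < 5)%N -> imem s2 0 k = imem s 0 k.
  by move=> k5; rewrite im ?pk//; lia.
rewrite /trim has_find -/p ltnNge; case: leqP => pp /=.
  split=> [|k k5]; last by rewrite /update /= [k == _]ltn_eqF// frame.
  split=> /=.
  - by rewrite /update /= frame.
  - by rewrite rm2 pr.
  - by move=> i j ni; rewrite rm2 pr [(n < _)%N]ltnNge ni/= rV.
  - by rewrite /update /= size_cat size_rcons addn1 addnS.
  - by move=> d q dl qn; rewrite rm2 ld1.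
  move=> d; rewrite size_cat size_rcons addnS ltnS leq_eqVlt /update /= => dl.
  rewrite !im// p2 p3 lenE; case: eqP dl => [-> _|_ /= dl].
    by right; rewrite nthg nthe -/e; split=> //; rewrite ltnS ltnW// ltn_addr.
  have := rpar d; rewrite size_cat nthL// => /(_ dl)[->|[pl pe]]; first by left.
  by right; rewrite nthL//; split=> //; rewrite ltnS ltnW.
split=> //; split=> //.
- by rewrite frame.
- by rewrite rm2 pr.
- by move=> i j ni; rewrite rm2 pr [(n < _)%N]ltnNge ni/= rV.
- by rewrite im// pk// rlen.
- move=> d q dl qn; rewrite rm2 ld1 ?nthL -?size_cat//.
  by rewrite size_cat size_rcons addnS ltnS ltnW// -size_cat.
move=> d dl; rewrite !im// p2 p3 lenE -size_cat (ltn_eqF dl).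
exact: rpar.
Qed.

End Program.

Section Building.
Variables (n : nat) (R : realType) (m : nat) (V : nat -> nat -> R) (rr : R).
Implicit Types (s : store R) (L acc lev : seq (seq nat)) (g : seq nat).
Variable N : nat.
Hypothesis rr_refl : forall g, close n V rr g g.
Hypothesis bound : forall L, {in L, forall g, (size g <= m)%N} ->
  spread_out n V rr L -> (size L <= N)%N.

Local Notation level := (level n V rr).
Local Notation represents := (represents n m V rr).

Definition try_const : nat :=
  (\sum_(a < n) ccost (propose n a) + bcost (close_test n) + 30)%N.

Lemma try_cost_le a : (a < n)%N -> (try_cost n a N <= try_const * N.+1)%N.
Proof.
move=> an; rewrite /try_cost /try_const (bigD1 (Ordinal an))//=.
by nia.
Qed.

Definition level_const : nat := (n * try_const.+1 + 50)%N.

Lemma size_trims L : {in L, forall g, (size g <= m)%N} ->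
  (size (trims n V rr L) <= N)%N.
Proof.
move=> H; apply: bound; last exact: trims_spread_out.
by move=> g /mem_trims /H.
Qed.

Lemma size_level j : (j <= m)%N -> (size (level j) <= N)%N.
Proof.
move=> jm; apply: bound; last exact: level_spread_out.
by move=> g /level_size ->.
Qed.

(** [L0] holds the earlier levels. They stay in memory because the chains of parents run through
    them. *)
Definition at_level s L0 j :=
  [/\ represents s (L0 ++ level j), imem s 0 1 = j, imem s 0 3 = size L0
    & imem s 0 4 = size (L0 ++ level j)].

Lemma extend_take lev k : (k < size lev)%N ->
  extend n (take k.+1 lev) =
  extend n (take k lev) ++ [seq rcons (nth [::] lev k) a | a <- iota 0 n].
Proof.
by move=> kl; rewrite (take_nth [::])// /extend -cats1 allpairs_cat/= cats0.
Qed.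

Lemma next_level_wp s L0 j : (j < m)%N -> at_level s L0 j ->
  wp (next_level n) (level_const * (N.+1 * N.+1))
    (fun s' => at_level s' (L0 ++ level j) j.+1) s.
Proof.
move=> jm [rep sJ sLO sHI]; set lev := level j in rep sHI *.
set L1 := L0 ++ lev in rep sHI *.
(* The nested loops visit entries and agents in the order in which [extend] lists them, so they
   carry out the fold [trims] literally. *)
pose I k s' := [/\ represents s' (L1 ++ trims n V rr (extend n (take k lev))),
  imem s' 0 2 = (size L0 + k)%N & forall l, l \in [:: 1; 3; 4]%N ->
  imem s' 0 l = imem s 0 l].
have step k s' : (k < size lev)%N -> I k s' ->
    wp (Seq (seqs n (try_agent n)) (inc 2))
      ((n * (try_const * N.+1).+1).+1 + ccost (inc 2)).+1 (I k.+1) s'.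
  move=> kl [rep' sE fr]; set g := nth [::] lev k.
  have g_lev : g \in lev by exact: mem_nth.
  have gj := level_size g_lev.
  have gL1 : nth [::] L1 (size L0 + k) = g.
    by rewrite nth_cat ltnNge leq_addr/= addKn.
  pose cs a := extend n (take k lev) ++ [seq rcons g b | b <- iota 0 a].
  pose I' a s'' := [/\ represents s'' (L1 ++ trims n V rr (cs a)),
    imem s'' 0 2 = (size L0 + k)%N & forall l, l \in [:: 1; 3; 4]%N ->
    imem s'' 0 l = imem s 0 l].
  have W : wp (seqs n (try_agent n)) (n * (try_const * N.+1).+1).+1 (I' n) s'.
    apply: wp_seqs => [a s2 an [rep2 sE2 fr2]|]; last by split; rewrite /cs ?cats0.
    have W2 : wp (try_agent n a) (try_cost n a N) (fun s' =>
        represents s' (L1 ++ trim n V rr (trims n V rr (cs a)) (rcons g a))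
        /\ forall l, (l < 5)%N -> imem s' 0 l = imem s2 0 l) s2.
      have := @try_agent_wp n R m V rr rr_refl a N s2 L1 _ rep2.
      rewrite sE2 gL1 !fr2//; apply=> //.
      - by rewrite size_cat ltn_add2l.
      - by rewrite sJ gj.
      - apply: size_trims => h; rewrite mem_cat => /orP[].
          by move=> /allpairsP[[h' b]/= [/mem_take /level_size hj _ ->]]; rewrite size_rcons hj.
        by move=> /mapP[b _ ->]; rewrite size_rcons gj.
    apply: wp_le (try_cost_le an) _ W2.
    move=> s3 [rep3 fr3]; split.
    - move: rep3; rewrite -trims_rcons.
      rewrite /cs -addn1 iotaD map_cat/= catA cats1.
      by rewrite add0n.
    - by rewrite fr3.
    - move=> l l134; rewrite fr3 ?fr2//.
      by move: l134; rewrite !inE; lia.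
  apply: wp_seq; apply: wp_le W => // s2 [rep2 sE2 fr2].
  apply: wp_run => //; split.
  - rewrite extend_take//; case: rep2 => *; split=> //.
  - by rewrite /= /update /= sE2 addn1 addnS.
  - by move=> l l134; rewrite -fr2//= /update /=; move: l134; rewrite !inE => /or3P[] /eqP ->.
rewrite /next_level.
have lf1 : loopfree (iset 2 pLO) by [].
set T := ((n * _).+1 + _).+1 in step.
apply: (@wp_le _ _ (ccost (iset 2 pLO) + ((size lev).+1 * (bcost (ILt pE pHI) + T).+1
   + ccost (Seq (iset 3 pHI) (Seq (iset 4 pLEN) (inc 1)))).+1).+1 _
   (fun s' => at_level s' L1 j.+1)) => //.
  have := size_level (ltnW jm); rewrite -/lev /T /level_const /= => lN.
  set X := (n * (try_const * N.+1).+1)%N.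
  apply: (@leq_trans (30 + N.+1 * (15 + X))%N).
    have : ((size lev).+1 * (15 + X) <= N.+1 * (15 + X))%N by rewrite leq_mul2r ltnS lN orbT.
    by lia.
  have X1 : (X <= n * try_const.+1 * N.+1)%N.
    by rewrite /X -mulnA leq_mul2l [(try_const.+1 * _)%N]mulSn; lia.
  have : ((15 + X) * N.+1 <= (15 + n * try_const.+1) * (N.+1 * N.+1))%N.
    by rewrite mulnA leq_mul2r mulnDl; lia.
  by rewrite !mulnDl; lia.
apply: wp_seq; apply: (wp_run lf1).
apply: wp_seq; apply: wp_le (leqnn _) _ (@wp_while _ I (size lev) T _ _ _ _ _ _) => //.
- move=> s2 [rep2 sE fr]; apply: wp_run => //.
  have [r1 r2 r3 r4 r5 r6] := rep2; rewrite take_size in rep2 r4 r5 r6.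
  split=> //=; rewrite /update /=.
  + by rewrite fr// sJ addn1.
  + by rewrite fr.
- move=> k s2 kl Ik; split; last exact: step.
  have [_ sE fr] := Ik; rewrite /= sE fr// sHI -ltnNge.
  by rewrite size_cat ltn_add2l.
- move=> s2 [_ sE fr]; rewrite /= sE fr// sHI negbK.
  by rewrite size_cat.
split=> //=.
- by rewrite take0 cats0; case: rep => *; split.
- by rewrite /update /= sLO addn0.
- by move=> l; rewrite !inE => /or3P[] /eqP ->.
Qed.

Lemma build_wp s : at_level s [::] 0 ->
  wp (build n) (m.+1 * (6 + level_const * (N.+1 * N.+1)).+1)
    (fun s' => exists L0, at_level s' L0 m) s.
Proof.
move=> s0; apply: wp_le (leqnn _) _ (@wp_while _
  (fun j s' => exists L0, at_level s' L0 j) m _ _ _ _ _ _ _).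
- by [].
- move=> j s1 jm [L0 H]; split; last first.
    by apply: wp_le (leqnn _) _ (next_level_wp jm H) => s2 H2; exists (L0 ++ level j).
  by have [rep sJ _ _] := H; rewrite /= sJ (rep_items rep) -ltnNge.
- by move=> s1 [L0 [rep sJ _ _]]; rewrite /= sJ (rep_items rep) negbK.
- by exists [::].
Qed.

End Building.

(** * Selecting and writing the output *)

Lemma run_seqs_ind (R : realType) (I : nat -> store R -> Prop) k f s :
  (forall i s, (i < k)%N -> I i s -> I i.+1 (run (f i) s)) ->
  I 0%N s -> I k (run (seqs k f) s).
Proof.
move=> step I0; elim: k step => //= k IH step; apply: (step) => //.
by apply: IH => i s' ik; apply: step; exact: ltnW.
Qed.

Section MinMax.
Variable R : realType.
Implicit Type f : nat -> R.

Fixpoint minf f k : R :=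
  if k is k'.+1 then if minf f k' <= f k' then minf f k' else f k' else f 0%N.

Lemma minf_le f k i : (i < k)%N -> minf f k <= f i.
Proof.
elim: k => //= k IH; rewrite ltnS leq_eqVlt => /predU1P[->|/IH H].
  by case: ifP.
by case: ifPn => // /negbTE; rewrite leNgt => /negbFE/ltW/le_trans; apply.
Qed.

Lemma minf_ge f k : (0 < k)%N -> exists2 i, (i < k)%N & f i <= minf f k.
Proof.
(* Writing [k.-1.+1] makes the claim true at [k = 0] as well, where [minf] is [f 0], and lets the
   induction start there. *)
move=> k0; suff [i ik fi] : exists2 i, (i < k.-1.+1)%N & f i <= minf f k.
  by exists i => //; rewrite prednK in ik.
elim: k {k0} => [|k [i ik fi]] /=; first by exists 0%N.
case: ifP => H; last by exists k.
by exists i => //; apply: leq_trans ik _; case: (k).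
Qed.

(* The value at [0] is a dummy. *)
Fixpoint maxf f k : R :=
  if k is k'.+1 then if (0 < k')%N && (f k' <= maxf f k') then maxf f k' else f k'
  else 0.

Lemma maxf_ge f k i : (i < k)%N -> f i <= maxf f k.
Proof.
elim: k => //= k IH; rewrite ltnS leq_eqVlt => /predU1P[->|ik].
  by case: ifPn => // /andP[].
rewrite (leq_ltn_trans _ ik)//=; case: ifP => [_|/negbT]; first exact: IH.
by rewrite -ltNge => /ltW; apply: le_trans; exact: IH.
Qed.

Lemma maxf_att f k : (0 < k)%N -> exists2 i, (i < k)%N & maxf f k = f i.
Proof.
elim: k => //= k IH _; case: ifPn => [/andP[/IH[i ik ->] _]|_]; last by exists k.
by exists i => //; exact: ltnW.
Qed.

End MinMax.

Section MaxMinCode.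
Variable n : nat.
Local Notation load_at q e := (RGet (n.+1 + q) e).

Definition min_code i : cmd :=
  Seq (rset 4 (load_at (i * n + 0) pE))
    (seqs n (fun k => If (RLe (rv 4) (load_at (i * n + k) pE)) Skip
                         (rset 4 (load_at (i * n + k) pE)))).

(** At the first entry, where [pE] equals [pLO], the running maximum is overwritten unconditionally:
    its initial content 0 would exceed every minimum for chores. *)
Definition max_code i : cmd :=
  Seq (min_code i)
    (If (BAnd (ILt pLO pE) (RLe (rv 4) (rv (10 + i)))) Skip (rset (10 + i) (rv 4))).

Definition maxmin : cmd :=
  Seq (iset 2 pLO) (While (ILt pE pHI) (Seq (seqs n max_code) (inc 2))).

Variable R : realType.
Implicit Type s : store R.

Lemma run_min_code i s :
  let s1 := run (min_code i) s in
  imem s1 = imem s /\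
  forall b l, rmem s1 b l = if (b == 0%N) && (l == 4%N)
    then minf (fun k => rmem s (n.+1 + (i * n + k))%N (imem s 0 2)) n
    else rmem s b l.
Proof.
rewrite /min_code; set f := fun k => If _ _ _; rewrite [run _ _]/=.
set s0 := Store _ _.
pose I k s1 := imem s1 = imem s /\
  forall b l, rmem s1 b l = if (b == 0%N) && (l == 4%N)
    then minf (fun k => rmem s (n.+1 + (i * n + k))%N (imem s 0 2)) k
    else rmem s b l.
apply: (run_seqs_ind (I := I)) => [k s1 kn [im rm]|] //.
set g := fun k => rmem s _ _ in rm *.
have r4 : rmem s1 0 4 = minf g k by rewrite rm.
have rx : rmem s1 (n.+1 + (i * n + k)) (imem s1 0 2) = g k by rewrite im rm.
rewrite /f /= r4 rx; case: ifP => H; split=> //= b l; first by rewrite rm H.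
by rewrite /update rm /= H; case: (_ && _).
Qed.

Lemma run_max_code i s :
  let s1 := run (max_code i) s in
  imem s1 = imem s /\
  forall b l, (b != 0%N) || (l != 4%N) -> rmem s1 b l =
    if (b == 0%N) && (l == 10 + i)%N then
      let x := minf (fun k => rmem s (n.+1 + (i * n + k))%N (imem s 0 2)) n in
      if (imem s 0 3 < imem s 0 2)%N && (x <= rmem s 0 (10 + i))
      then rmem s 0 (10 + i) else x
    else rmem s b l.
Proof.
have [H1 H2] := run_min_code i s; rewrite /max_code.
rewrite [run (Seq _ _) s]/=; set s1 := run (min_code i) s in H1 H2 *.
rewrite !H1 !H2 /= -ltnNge; case: ifP => C; split=> //= b l bl.
  rewrite H2; case: ifP => [/andP[/eqP b0 /eqP l0]|_]; first by rewrite b0 l0 in bl.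
  by case: ifP => // /andP[/eqP -> /eqP ->].
rewrite /update H2 /=; case: ifP => // _.
by case: ifP => // /andP[/eqP b0 /eqP l0]; rewrite b0 l0 in bl.
Qed.

Lemma loopfree_max_code i : loopfree (max_code i).
Proof. by rewrite /= loopfree_seqs. Qed.

Variable V : nat -> nat -> R.
Local Notation load := (load n V).

Definition loads s L0 (lev : seq (seq nat)) := forall d q,
  (d < size lev)%N -> (q < n * n)%N ->
  rmem s (n.+1 + q)%N (L0 + d)%N = load q (nth [::] lev d).

Definition min_load i g := minf (fun k => load (i * n + k) g) n.

Definition maxmin_value (lev : seq (seq nat)) i :=
  maxf (fun d => min_load i (nth [::] lev d)) (size lev).

Lemma eq_minf (f g : nat -> R) k : (0 < k)%N ->
  (forall i, (i < k)%N -> f i = g i) -> minf f k = minf g k.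
Proof.
move=> k0 fg; have f0 := fg 0%N k0.
elim: k {k0} fg => //= k IH fg; rewrite IH ?fg// => i ik.
by apply: fg; exact: ltnW.
Qed.

Definition maxmin_const : nat := (ccost (Seq (seqs n max_code) (inc 2)) + 20)%N.

Lemma maxmin_wp s L0 lev N : (size lev <= N)%N -> loads s L0 lev ->
  imem s 0 3 = L0 -> imem s 0 4 = (L0 + size lev)%N -> (0 < size lev)%N ->
  wp maxmin (maxmin_const * N.+1)
    (fun s' => [/\ forall b l, (b != 0%N) || (l != 2%N) -> imem s' b l = imem s b l,
       forall b l, b != 0%N -> rmem s' b l = rmem s b l
       & forall i, (i < n)%N -> rmem s' 0 (10 + i) = maxmin_value lev i]) s.
Proof.
move=> lN ld sLO sHI lev0.
pose F i d := min_load i (nth [::] lev d).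
pose I d s' := [/\ imem s' 0 2 = (L0 + d)%N,
  forall b l, (b != 0%N) || (l != 2%N) -> imem s' b l = imem s b l,
  forall b l, b != 0%N -> rmem s' b l = rmem s b l
  & forall i, (i < n)%N -> (0 < d)%N -> rmem s' 0 (10 + i) = maxf (F i) d].
apply: (@wp_le _ _ (ccost (iset 2 pLO) +
  (size lev).+1 * (bcost (ILt pE pHI) + ccost (Seq (seqs n max_code) (inc 2))).+1).+1 _
  (I (size lev))); last first.
- apply: wp_seq; apply: wp_run => //; apply: wp_while => [d s1 dl|s1|].
  + move=> [sE im rm mx]; split; first by rewrite /= sE !im// sHI -ltnNge ltn_add2l.
    apply: wp_run; first by rewrite /= loopfree_seqs//; exact: loopfree_max_code.
    rewrite [run _ _]/=.
    (* Midway through entry [d], only agents below [k] have taken it into account; the disjunct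
       [0 < d] keeps the still uninitialised maxima out of the claim. *)
    pose I' k s' := [/\ imem s' = imem s1,
      forall b l, b != 0%N -> rmem s' b l = rmem s b l
      & forall i, (i < n)%N -> ((i < k) || (0 < d))%N ->
          rmem s' 0 (10 + i) = maxf (F i) (if (i < k)%N then d.+1 else d)].
    have [im2 rm2 mx2] : I' n (run (seqs n max_code) s1).
      apply: run_seqs_ind => [i s2 ni [im2 rm2 mx2]|]; last first.
        by split=> // i ni /=; exact: mx.
      have [H1 H2] := run_max_code i s2.
      set s3 := run _ s2 in H1 H2 *.
      have E : minf (fun k => rmem s2 (n.+1 + (i * n + k))%N (imem s2 0 2)) n = F i d.
        apply: eq_minf => [|k kn]; first exact: leq_ltn_trans ni.
        by rewrite rm2// im2 sE ld// coord_lt.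
      split=> [|b l b0|i' ni' ii'].
      * by rewrite H1.
      * by rewrite H2 ?b0//= (negbTE b0)/= rm2.
      * rewrite H2// eqn_add2l /= E; case: eqP => [->|ne].
          rewrite ltnSn/= im2 sE im// sLO -[X in (X < _)%N]addn0 ltn_add2l.
          case: (posnP d) => [-> //|d0] /=.
          by rewrite mx2// ?d0 ?orbT// ltnn.
        have -> : (i' < i.+1)%N = (i' < i)%N.
          by rewrite ltnS leq_eqVlt; case: eqP => // ei; case: ne; rewrite ei.
        by apply: mx2 => //; move: ii'; rewrite ltnS leq_eqVlt; case: eqP => // ei; case: ne; rewrite ei.
    split=> /=.
    * by rewrite /update /= im2 sE addn1 addnS.
    * by move=> b l bl; rewrite /update im2 -im//; case: ifP bl => // /andP[/eqP -> /eqP ->].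
    * exact: rm2.
    * by move=> i ni _; rewrite mx2 ?ni.
  + by move=> [sE im _ _]; rewrite /= sE !im// sHI negbK.
  + split=> //=.
    * by rewrite /update /= sLO addn0.
    * by move=> b l bl; rewrite /update; case: ifP bl => // /andP[/eqP -> /eqP ->].
- by move=> s' [_ im rm mx]; split=> // i ni; rewrite mx.
- rewrite /maxmin_const; set T := ccost (Seq _ _); rewrite /=.
  have : ((size lev).+1 * (7 + T) <= N.+1 * (7 + T))%N by rewrite leq_mul2r ltnS lN orbT.
  by lia.
Qed.

End MaxMinCode.

Section SelectCode.
Variable n : nat.
Local Notation load_at q e := (RGet (n.+1 + q) e).
(* The scores and the welfares of the entries are kept in two more arrays. *)
Local Notation score_at e := (RGet (n.+1 + n * n) e).
Local Notation welfare_at e := (RGet (n.+2 + n * n) e).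

Definition cap e : cmd :=
  If (RLe (score_at pE) e) Skip (RSet (n.+1 + n * n) pE e).

Definition score_code : cmd :=
  Seq (RSet (n.+1 + n * n) pE ROne)
    (seqs n (fun i => let x := load_at (i * n + i) pE in
       If (RLe (rv (10 + i)) x) Skip
         (If (RLe RZero x) (cap (RDiv x (rv (10 + i)))) (cap (RDiv (rv (10 + i)) x))))).

Definition welfare_code : cmd :=
  Seq (RSet (n.+2 + n * n) pE RZero)
    (seqs n (fun i => RSet (n.+2 + n * n) pE
                        (RAdd (welfare_at pE) (load_at (i * n + i) pE)))).

Definition pick_code : cmd :=
  If (BAnd (RLe (score_at pE) (score_at pB))
       (BNot (BAnd (RLe (score_at pB) (score_at pE)) (RLt (welfare_at pB) (welfare_at pE)))))
    Skip (iset 7 pE).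

Definition select : cmd :=
  Seq (iset 7 pLO) (Seq (iset 2 pLO) (While (ILt pE pHI)
    (Seq score_code (Seq welfare_code (Seq pick_code (inc 2)))))).

Variable R : realType.
Implicit Type s : store R.

Lemma run_score_code s :
  let s1 := run score_code s in
  imem s1 = imem s /\
  forall b l, rmem s1 b l = if (b == n.+1 + n * n)%N && (l == imem s 0 2)
    then score (fun i => rmem s 0 (10 + i)%N)
               (fun i => rmem s (n.+1 + (i * n + i))%N (imem s 0 2)) n
    else rmem s b l.
Proof.
rewrite /score_code; set f := fun i => _; rewrite [run _ _]/=.
set s0 := Store _ _.
set M := fun i => rmem s 0 _; set x := fun i => rmem s _ (imem s 0 2).
pose I k s1 := imem s1 = imem s /\
  forall b l, rmem s1 b l = if (b == n.+1 + n * n)%N && (l == imem s 0 2)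
    then score M x k else rmem s b l.
apply: (run_seqs_ind (I := I)) => [k s1 kn [im rm]|] //.
have rS : rmem s1 (n.+1 + n * n) (imem s1 0 2) = score M x k by rewrite im rm !eqxx.
have rM : rmem s1 0 (10 + k) = M k by rewrite rm.
have rx : rmem s1 (n.+1 + (k * n + k)) (imem s1 0 2) = x k.
  by rewrite im rm eqn_add2l ltn_eqF// coord_lt.
rewrite /f /= rM rx.
case: ifP => H1; first by split=> // b l; rewrite rm /= H1.
case: ifP => H2 /=; rewrite ?rM ?rx rS.
  case: ifP => H3; split=> //= b l; rewrite /update ?im rm /= H1 H2 H3 //.
  by case: (_ && _).
case: ifP => H3; split=> //= b l; rewrite /update ?im rm /= H1 H2 H3 //.
by case: (_ && _).
Qed.

Lemma run_welfare_code s :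
  let s1 := run welfare_code s in
  imem s1 = imem s /\
  forall b l, rmem s1 b l = if (b == n.+2 + n * n)%N && (l == imem s 0 2)
    then \sum_(i < n) rmem s (n.+1 + (i * n + i))%N (imem s 0 2)
    else rmem s b l.
Proof.
rewrite /welfare_code; set f := fun i => _; rewrite [run _ _]/=.
set s0 := Store _ _.
pose I k s1 := imem s1 = imem s /\
  forall b l, rmem s1 b l = if (b == n.+2 + n * n)%N && (l == imem s 0 2)
    then \sum_(i < k) rmem s (n.+1 + (i * n + i))%N (imem s 0 2) else rmem s b l.
apply: (run_seqs_ind (I := I)) => [k s1 kn [im rm]|].
  split=> //= b l; rewrite /update im !rm.
  rewrite !eqxx/= [(n.+1 + (k * n + k) == _)%N]ltn_eqF/=; last first.
    by have := coord_lt kn kn; lia.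
  by rewrite big_ord_recr/=; case: (_ && _).
by split=> //= b l; rewrite big_ord0.
Qed.

Variable V : nat -> nat -> R.
Local Notation load := (load n V).

Lemma better_trans M g h k : better n V M g h -> better n V M h k -> better n V M g k.
Proof.
by rewrite /better; set a := score _ _ _; set b := score _ _ _; set c := score _ _ _; lra.
Qed.

Lemma better_irr M g : better n V M g g = false.
Proof. by rewrite /better !ltxx andbF. Qed.

Definition select_const : nat :=
  (ccost (Seq score_code (Seq welfare_code (Seq pick_code (inc 2)))) + 30)%N.

Lemma eq_score (M M' x x' : nat -> R) k :
  (forall i, (i < k)%N -> M i = M' i) -> (forall i, (i < k)%N -> x i = x' i) ->
  score M x k = score M' x' k.
Proof.
elim: k => //= k IH HM Hx; rewrite HM// Hx// IH// => i ik.
  by apply: HM; exact: ltnW.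
by apply: Hx; exact: ltnW.
Qed.

Lemma select_wp s L0 lev (M : nat -> R) N : (size lev <= N)%N -> loads n V s L0 lev ->
  imem s 0 3 = L0 -> imem s 0 4 = (L0 + size lev)%N -> (0 < size lev)%N ->
  (forall i, (i < n)%N -> rmem s 0 (10 + i) = M i) ->
  wp select (select_const * N.+1)
    (fun s' => [/\
       forall b l, (b != 0%N) || (l != 2%N) && (l != 7%N) -> imem s' b l = imem s b l
       & exists2 d, (d < size lev)%N /\ imem s' 0 7 = (L0 + d)%N &
         {in lev, forall h, ~~ better n V M h (nth [::] lev d)}]) s.
Proof.
move=> lN ld sLO sHI lev0 sM.
pose sc d := score M (own n V (nth [::] lev d)) n.
pose wf d := welfare n V (nth [::] lev d).
pose I d s' := [/\ imem s' 0 2 = (L0 + d)%N,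
  forall b l, (b != 0%N) || (l != 2%N) && (l != 7%N) -> imem s' b l = imem s b l,
  forall b l, (b < n.+1 + n * n)%N -> rmem s' b l = rmem s b l,
  forall d', (d' < d)%N -> rmem s' (n.+1 + n * n) (L0 + d') = sc d' /\
                           rmem s' (n.+2 + n * n) (L0 + d') = wf d'
  & exists2 p, (p <= d.-1)%N /\ imem s' 0 7 = (L0 + p)%N &
    forall d', (d' < d)%N -> ~~ better n V M (nth [::] lev d') (nth [::] lev p)].
rewrite /select; set body := Seq score_code _.
apply: (@wp_le _ _ (ccost (iset 7 pLO) + (ccost (iset 2 pLO) +
  (size lev).+1 * (bcost (ILt pE pHI) + ccost body).+1).+1).+1 _ (I (size lev))).
- rewrite /select_const -/body; set T := ccost body; rewrite /=.
  have : ((size lev).+1 * (7 + T) <= N.+1 * (7 + T))%N by rewrite leq_mul2r ltnS lN orbT.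
  by lia.
- move=> s' [_ im _ _ [p [pd p7] best]]; split=> //; exists p.
    by rewrite p7; split=> //; move: pd lev0; lia.
  by move=> h /(nthP [::])[d' dl <-]; exact: best.
apply: wp_seq; apply: wp_run => //; apply: wp_seq; apply: wp_run => //.
apply: wp_while => [d s1 dl|s1|].
- move=> [sE im rm scs [p [pd p7] best]].
  split; first by rewrite /= sE !im// sHI -ltnNge ltn_add2l.
  apply: wp_run.
    by rewrite /body /= loopfree_seqs//= loopfree_seqs.
  rewrite -[run body s1]/(run (inc 2) (run pick_code
             (run welfare_code (run score_code s1)))).
  have [H1 H2] := run_score_code s1.
  set s2 := run score_code s1 in H1 H2 *; clearbody s2.
  have [H3 H4] := run_welfare_code s2.
  set s3 := run welfare_code s2 in H3 H4 *; clearbody s3.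
  have own1 i : (i < n)%N ->
      rmem s1 (n.+1 + (i * n + i)) (imem s1 0 2) = own n V (nth [::] lev d) i.
    by move=> ni; rewrite rm ?ltn_add2l ?coord_lt// sE ld// coord_lt.
  have scE : score (fun i => rmem s1 0 (10 + i)%N)
      (fun i => rmem s1 (n.+1 + (i * n + i))%N (imem s1 0 2)) n = sc d.
    by apply: eq_score => i ni; [rewrite rm// sM|exact: own1].
  have wfE : \sum_(i < n) rmem s2 (n.+1 + (i * n + i))%N (imem s2 0 2) = wf d.
    apply: eq_bigr => i _; rewrite H1 H2 eqn_add2l [(_ == n * n)%N]ltn_eqF/= ?coord_lt//.
    exact: own1.
  rewrite scE in H2; rewrite wfE in H4.
  have im3 : imem s3 = imem s1 by rewrite H3.
  have rm3 b l : (b < n.+1 + n * n)%N -> rmem s3 b l = rmem s b l.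
    move=> bn; rewrite H4 [(b == _)]ltn_eqF/=; last by rewrite (ltn_trans bn).
    by rewrite H2 [(b == _)]ltn_eqF//= rm.
  have scs3 d' : (d' < d.+1)%N -> rmem s3 (n.+1 + n * n) (L0 + d') = sc d' /\
                           rmem s3 (n.+2 + n * n) (L0 + d') = wf d'.
    have r1 : rmem s3 (n.+1 + n * n) (L0 + d') =
        if d' == d then sc d else rmem s1 (n.+1 + n * n) (L0 + d').
      by rewrite H4 [(_ == n.+2 + _)%N]ltn_eqF//= H2 eqxx sE eqn_add2l.
    have r2 : rmem s3 (n.+2 + n * n) (L0 + d') =
        if d' == d then wf d else rmem s1 (n.+2 + n * n) (L0 + d').
      by rewrite H4 eqxx H1 sE eqn_add2l/= H2 [(_ == n.+1 + _)%N]gtn_eqF.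
    rewrite r1 r2 ltnS leq_eqVlt; case: (eqVneq d' d) => [->//|_ /= d'd].
    exact: scs.
  (* At the first entry [p = d = 0]: the entry is compared with itself, after its own score and
     welfare have been stored. *)
  have pS : (p < d.+1)%N by move: pd; lia.
  have [scp wfp] := scs3 p pS; have [scd wfd] := scs3 d (ltnSn d).
  have -> : run pick_code s3 =
      if ~~ better n V M (nth [::] lev d) (nth [::] lev p) then s3
      else run (iset 7 pE) s3.
    rewrite /= im3 sE p7 scp wfp scd wfd /better negb_or -leNgt.
    by rewrite -ltNge.
  case: ifPn => Hb; split=> //=.
  + by rewrite /update /= im3 sE addn1 addnS.
  + by move=> b l bl; rewrite -im// /update im3; case: ifP bl => // /andP[/eqP -> /eqP ->].
  + exists p; first by split; [|rewrite /update /= im3].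
    by move=> d'; rewrite ltnS leq_eqVlt => /predU1P[->//|]; exact: best.
  + by rewrite /update /= im3 sE addn1 addnS.
  + move=> b l bl; rewrite -im// /update im3; case: ifP bl => [/andP[/eqP -> /eqP ->]//|_].
    by case: ifP => // /andP[/eqP -> /eqP ->].
  + exists d; first by split; [|rewrite /update /= im3 sE].
    move=> d'; rewrite ltnS leq_eqVlt => /predU1P[->|/best]; first by rewrite better_irr.
    by apply: contra => Hd; apply: better_trans Hd _; rewrite negbK in Hb.
- by move=> [sE im _ _ _]; rewrite /= sE !im// sHI negbK.
- split=> //=.
  + by rewrite /update /= sLO addn0.
  + move=> b l bl; rewrite /update; case: ifP bl => [/andP[/eqP -> /eqP ->]//|_].
    by case: ifP => // /andP[/eqP -> /eqP ->].
  + by exists 0%N => //; split=> //; rewrite /update /= sLO addn0.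
Qed.

End SelectCode.

Section Output.
Variables (R : realType) (m : nat).

(** An entry stores only its parent and its last agent, so extending takes time independent of [m];
    the full assignment is recovered once, from the last item to the first. *)
Definition backtrack : cmd :=
  Seq (iset 6 pB) (While (ILt (ILit 0) pJ)
    (Seq (iset 1 (ISub pJ (ILit 1)))
      (Seq (ISet 1 pJ (IGet 3 pF)) (iset 6 (IGet 2 pF))))).

Lemma backtrack_wp (s : store R) L G :
  (forall e, (e < size L)%N -> nth [::] L e = [::] \/
    ((imem s 2 e < size L)%N /\
     nth [::] L e = rcons (nth [::] L (imem s 2 e)) (imem s 3 e))) ->
  imem s 0 1 = m -> (imem s 0 7 < size L)%N -> nth [::] L (imem s 0 7) = G ->
  size G = m ->
  wp backtrack (50 * m.+1)
    (fun s' => forall j, (j < m)%N -> imem s' 1 j = nth 0%N G j) s.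
Proof.
move=> par sJ sB GE Gm.
pose I k (s' : store R) := [/\ imem s' 0 1 = (m - k)%N, (imem s' 0 6 < size L)%N,
  nth [::] L (imem s' 0 6) = take (m - k) G,
  forall b l, (1 < b)%N -> imem s' b l = imem s b l
  & forall j, (m - k <= j < m)%N -> imem s' 1 j = nth 0%N G j].
rewrite /backtrack; set body := Seq (iset 1 _) _.
apply: (@wp_le _ _ (ccost (iset 6 pB) +
   m.+1 * (bcost (ILt (ILit 0) pJ) + ccost body).+1).+1 _ (I m)).
- by rewrite /=; lia.
- by move=> s' [_ _ _ _ H] j jm; apply: H; rewrite subnn.
apply: wp_seq; apply: wp_run => //; apply: wp_while => [k s1 km [iJ iF nF im out]|s1 [iJ _ _ _ _]|].
- have mk : (m - k = (m - k.+1).+1)%N by lia.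
  split; first by rewrite /= iJ mk.
  apply: wp_run => //; rewrite /body /=.
  have := par _ iF; rewrite nF.
  (* Since [k < m], the current prefix is nonempty and so its entry has a parent. *)
  case=> [/(congr1 size)|]; first by rewrite size_takel ?Gm; [rewrite mk|lia].
  rewrite mk (take_nth 0%N) ?Gm; last lia.
  move=> [pl /eqP]; rewrite eqseq_rcons => /andP[/eqP tE /eqP aE].
  rewrite /update /= iJ !(im 2)// !(im 3)//.
  split=> //=.
  + by lia.
  + by move=> b l; case: b => [|[|b]] //= _; rewrite im.
  + move=> j jm; rewrite /update /=; case: eqP => [->|jk].
      by rewrite -aE mk subn1.
    by apply: out; rewrite mk; move: jk jm; lia.
- by rewrite /= iJ subnn.
- split=> //=.
  + by rewrite subn0.
  + by rewrite /update /= GE subn0 -Gm take_size.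
  + by move=> b l; case: b.
  + by move=> j; rewrite subn0 => /andP[a /(leq_ltn_trans a)]; rewrite ltnn.
Qed.

End Output.

(** * The algorithm and its running time *)

Section TrimRatio.
Variable R : realType.
Implicit Types eps gam x : R.

(** With [h = 1 + 3 / eps + 1 / gam], the reciprocal of [h] is at most each of 1, [eps / 3] and
    [gam]. The accuracy is [h + 1], where the extra 1 absorbs the compounding of the error over [m]
    items. *)
Definition accuracy eps gam : R := 2 + 3 / eps + 1 / gam.

Definition trim_ratio eps gam m : R := 1 + 1 / (accuracy eps gam * (m.+1)%:R).

Lemma accuracy_ge2 eps gam : 0 < eps -> 0 < gam -> 2 <= accuracy eps gam.
Proof.
move=> e0 g0; rewrite /accuracy -addrA lerDl addr_ge0// divr_ge0//; exact: ltW.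
Qed.

Lemma trim_ratio_gt1 eps gam m : 0 < eps -> 0 < gam -> 1 < trim_ratio eps gam m.
Proof.
move=> e0 g0; rewrite /trim_ratio ltrDl divr_gt0// mulr_gt0//.
by have := accuracy_ge2 e0 g0; lra.
Qed.

(** A Bernoulli-type bound, by induction from [(1 + x) * (1 - (k + 1) * x) <= 1 - k * x]. *)
Lemma expr1D_le x k : 0 <= x -> k%:R * x <= 1 -> (1 + x) ^+ k * (1 - k%:R * x) <= 1.
Proof.
move=> x0; elim: k => [|k IH] kx; first by rewrite expr0 mul0r subr0 mulr1.
have kx0 : 0 <= k%:R * x by rewrite mulr_ge0.
rewrite -natr1 mulrDl mul1r in kx *.
apply: le_trans (IH _); last by lra.
rewrite exprSr -mulrA ler_wpM2l ?exprn_ge0//; first lra.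
have xx : 0 <= x * x by rewrite mulr_ge0.
have kxx : 0 <= k%:R * x * x by rewrite mulr_ge0.
by nra.
Qed.

(** For [r = 1 + x] one has [m * x <= 1 / (1 + h)], so the preceding bound gives
    [r ^+ m <= (1 + h) / h]. *)
Lemma trim_ratio_expr eps gam m : 0 < eps -> 0 < gam ->
  trim_ratio eps gam m ^+ m <= 1 + 1 / (1 + 3 / eps + 1 / gam).
Proof.
move=> e0 g0; set h := 1 + 3 / eps + 1 / gam.
have h1 : 1 <= h by rewrite /h -addrA lerDl addr_ge0// divr_ge0// ltW.
have aE : accuracy eps gam = 1 + h by rewrite /accuracy /h; ring.
set x := 1 / (accuracy eps gam * (m.+1)%:R).
have x0 : 0 <= x by rewrite /x aE divr_ge0// mulr_ge0//; lra.
have mx : m%:R * x <= 1 / (1 + h).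
  rewrite /x aE ler_pdivlMr; last lra.
  rewrite !mul1r mulrAC ler_pdivrMr; last by rewrite mulr_gt0//; lra.
  by rewrite mul1r mulrC ler_wpM2l ?ler_nat//; lra.
have h0 : 1 / (1 + h) <= 1 by rewrite ler_pdivrMr; lra.
have := expr1D_le x0 (le_trans mx h0).
rewrite -/(trim_ratio _ _ _); set c := _ ^+ m => H.
have c0 : 0 <= c by rewrite exprn_ge0// ltW// (lt_trans ltr01) ?trim_ratio_gt1.
have : c * (h / (1 + h)) <= 1.
  apply: le_trans H; rewrite ler_wpM2l//.
  have -> : h / (1 + h) = 1 - 1 / (1 + h) by field; lra.
  by lra.
rewrite mulrA ler_pdivrMr ?mul1r; last lra.
rewrite -ler_pdivlMr; last lra.
by move=> /le_trans; apply; rewrite mulrDl divff ?mul1r; lra.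
Qed.

(** Since [z <= 1 + z ^+ 2], both [1 / eps] and [1 / gam] are at most [1 + 1 / mu]. The sum is then
    at most [6 + 4 / mu], hence at most [6 * (1 + 1 / mu)]. *)
Lemma accuracy_expR eps gam : 0 < eps -> 0 < gam ->
  accuracy eps gam <= 6 * expR (1 / Num.min (eps ^+ 2) (gam ^+ 2)).
Proof.
move=> e0 g0; set mu := Num.min _ _.
have mu0 : 0 < mu by rewrite lt_min !exprn_gt0.
have inv (y : R) : 0 < y -> mu <= y ^+ 2 -> 1 / y <= 1 + 1 / mu.
  move=> y0 muy; apply: (@le_trans _ _ (1 + (1 / y) ^+ 2)).
    by set z := 1 / y; have := sqr_ge0 (z - 1); rewrite !expr2; nra.
  by rewrite lerD2l expr_div_n expr1n !div1r lef_pV2 ?posrE ?exprn_gt0.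
have := inv _ e0; rewrite /mu ge_min lexx => /(_ isT) He.
have := inv _ g0; rewrite /mu ge_min lexx orbT => /(_ isT) Hg.
have := expR_ge1Dx (1 / mu); rewrite -/mu in He Hg *.
have i0 : 0 <= 1 / mu by rewrite divr_ge0// ltW.
have e3 : 3 / eps = 3 * (1 / eps) by rewrite div1r.
by rewrite /accuracy e3; lra.
Qed.

Lemma level_bound_le (n : nat) eps gam m : 0 < eps -> 0 < gam ->
  (level_bound n (trim_ratio eps gam m) m)%:R <=
    (7 * (m.+1)%:R ^+ 3 * expR (1 / Num.min (eps ^+ 2) (gam ^+ 2))) ^+ (n * n).
Proof.
move=> e0 g0; rewrite /level_bound natrX; set E := expR _.
have mu0 : 0 < Num.min (eps ^+ 2) (gam ^+ 2) by rewrite lt_min !exprn_gt0.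
have E1 : 1 <= E by rewrite -expR0 ler_expR divr_ge0// ltW.
have a2 := accuracy_ge2 e0 g0; have aE := accuracy_expR e0 g0; rewrite -/E in aE.
apply: lerXn2r; rewrite ?nnegrE ?ler0n ?mulr_ge0 ?exprn_ge0 ?expR_ge0//.
have mesh_le : (mesh (trim_ratio eps gam m) m)%:R <= m%:R * (6 * E * (m.+1)%:R).
  have r0 : trim_ratio eps gam m - 1 = 1 / (accuracy eps gam * (m.+1)%:R).
    by rewrite /trim_ratio addrAC subrr add0r.
  have acc0 : 0 < accuracy eps gam * (m.+1)%:R by rewrite mulr_gt0//; lra.
  rewrite /mesh r0 div1r invrK.
  apply: le_trans (_ : m%:R * (accuracy eps gam * (m.+1)%:R) <= _).
    by rewrite truncn_le mulr_ge0// ltW.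
  by rewrite ler_wpM2l// ler_wpM2r.
(* The number of cells is [m * mesh + (m + 1)]; the first term is at most 6 and the second at most 1
   times [(m + 1) ^+ 3 * E], which explains the 7. *)
rewrite -[X in X%:R]addn1 natrD natrM -[(mesh _ _).+1]addn1 natrD.
set M := (m%:R : R) in mesh_le *; have M0 : 0 <= M by exact: ler0n.
have mE : (m.+1)%:R = M + 1 :> R by rewrite -natr1.
rewrite mE in mesh_le *; set z := (mesh _ _)%:R in mesh_le *.
have : M * z <= M * (M * (6 * E * (M + 1))) by rewrite ler_wpM2l.
have ME : M + 1 <= (M + 1) * E by rewrite ler_peMr//; lra.
have M1 : (M + 1) * E <= (M + 1) ^+ 3 * E.
  by rewrite ler_wpM2r ?expR_ge0// ler_eXnr//; lra.
have M2 : M * (M * (6 * E * (M + 1))) <= 6 * ((M + 1) ^+ 3 * E).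
  have -> : M * (M * (6 * E * (M + 1))) = 6 * (M ^+ 2 * (M + 1) * E) by ring.
  rewrite ler_pM2l// ler_wpM2r ?expR_ge0// [leRHS]exprSr ler_wpM2r//; first lra.
  by rewrite lerXn2r ?nnegrE//; lra.
by rewrite mulrDr -[7 * _ * E]mulrA; lra.
Qed.

End TrimRatio.

Section Algorithm.
Variable n : nat.

(** The language has no conversion from integers to reals, so the real number [m + 1] is obtained by
    repeated addition of 1. *)
Definition count_items : cmd :=
  Seq (rset 2 ROne) (While (ILt pJ pM) (Seq (rset 2 (RAdd (rv 2) ROne)) (inc 1))).

Definition setup : cmd :=
  let three := RAdd ROne (RAdd ROne ROne) in
  Seq (rset 3 (RAdd ROne (RDiv ROne (RMul
         (RAdd (RAdd (RAdd ROne ROne) (RDiv three (rv 0))) (RDiv ROne (rv 1)))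
         (rv 2)))))
    (Seq (rset 3 (RMul (rv 3) (rv 3)))
      (Seq (iset 1 (ILit 0)) (Seq (iset 4 (ILit 1)) (iset 5 (ILit 1))))).

Definition algorithm : cmd :=
  Seq count_items (Seq setup
    (Seq (build n) (Seq (maxmin n) (Seq (select n) backtrack)))).

Definition algorithm_const : nat :=
  (300 + level_const n + maxmin_const n + select_const n)%N.

Variables (R : realType) (eps gam : R) (m : nat) (v : 'I_n -> 'I_m -> R).

(** Reading the initial store extends [v] by 0 to all indices, so the sign condition holds without
    range restrictions. *)
Definition valuation (i j : nat) : R := rmem (input eps gam v) i.+1 j.

Local Notation V := valuation.

Lemma valuationE (i : 'I_n) (j : 'I_m) : V i j = v i j.
Proof.
rewrite /valuation/= (nth_map i) ?size_enum_ord// nth_ord_enum.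
by rewrite (nth_map j) ?size_enum_ord// nth_ord_enum.
Qed.

Lemma valuation_out (i j : nat) : ~~ ((i < n)%N && (j < m)%N) -> V i j = 0.
Proof.
rewrite negb_and -!leqNgt /valuation/= => /orP[ni|mj].
  by rewrite [nth [::] _ i]nth_default ?nth_nil// size_map size_enum_ord.
case: (ltnP i n) => ni.
  rewrite (nth_map (Ordinal ni)) ?size_enum_ord// nth_default//.
  by rewrite size_map size_enum_ord.
by rewrite [nth [::] _ i]nth_default ?nth_nil// size_map size_enum_ord.
Qed.

Lemma valuation_sign : goods_manna v \/ chores_manna v ->
  (forall i j, 0 <= V i j) \/ (forall i j, V i j <= 0).
Proof.
have V0 i j : V i j = 0 \/ exists i' j', V i j = v i' j'.
  case: (boolP ((i < n)%N && (j < m)%N)) => [/andP[ni mj]|/valuation_out]; last by left.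
  right; exists (Ordinal ni), (Ordinal mj).
  by rewrite -[i]/(val (Ordinal ni)) -[j]/(val (Ordinal mj)) valuationE.
case=> H; [left|right] => i j; case: (V0 i j) => [->//|[i' [j' ->]]].
  exact: H.
exact: ltW (H _ _).
Qed.

Lemma count_items_wp (s : store R) : imem s 0 0 = m -> imem s 0 1 = 0%N ->
  wp count_items (10 + m.+1 * 30).+1
    (fun s' => [/\ forall k, k != 1%N -> imem s' 0 k = imem s 0 k,
       rmem s' 0 2 = (m.+1)%:R
       & forall b l, (b != 0%N) || (l != 2%N) -> rmem s' b l = rmem s b l]) s.
Proof.
move=> sm sj.
pose I j s' := [/\ imem s' 0 1 = j, forall k, k != 1%N -> imem s' 0 k = imem s 0 k,
  rmem s' 0 2 = (j.+1)%:R
  & forall b l, (b != 0%N) || (l != 2%N) -> rmem s' b l = rmem s b l].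
apply: (@wp_le _ _ (ccost (rset 2 ROne) + m.+1 * (bcost (ILt pJ pM) +
  ccost (Seq (rset 2 (RAdd (rv 2) ROne)) (inc 1))).+1).+1 _ (I m)).
- by rewrite /=; lia.
- by move=> s' [].
apply: wp_seq; apply: wp_run => //; apply: wp_while => [j s1 jm [s1j im r2 rm]|s1 [s1j im _ _]|].
- split; first by rewrite /= im// s1j sm -ltnNge.
  apply: wp_run => //; split=> /=.
  + by rewrite /update /= s1j addn1.
  + by move=> k k1; rewrite /update /= (negbTE k1) im.
  + by rewrite /update /= r2 natr1.
  + by move=> b l bl; rewrite /update -(rm _ _ bl); case: ifP bl => // /andP[/eqP -> /eqP ->].
- by rewrite /= s1j im// sm leqnn.
- split=> //=.
  by move=> b l bl; rewrite /update; case: ifP bl => // /andP[/eqP -> /eqP ->].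
Qed.

Local Notation r := (trim_ratio eps gam m).
Local Notation L := (level n V (r * r) m).
Local Notation N := (level_bound n r m).

Hypotheses (n0 : (0 < n)%N) (eps0 : 0 < eps) (gam0 : 0 < gam).
Hypothesis v_sign : goods_manna v \/ chores_manna v.

Lemma level_nonempty : (0 < size L)%N.
Proof.
have r1 := ltW (trim_ratio_gt1 m eps0 gam0).
have [|h + _] := @level_cover R n V r r1 (valuation_sign v_sign) (nseq m 0%N).
  by rewrite all_nseq n0 orbT.
by rewrite size_nseq; case: (level _ _ _ _).
Qed.

Lemma algorithm_wp :
  wp algorithm (algorithm_const * (m.+1 * (N.+1 * N.+1)))
    (fun s => exists G, [/\ G \in L,
       {in L, forall h, ~~ better n V (maxmin_value n V L) h G}
       & forall j, (j < m)%N -> imem s 1 j = nth 0%N G j]) (input eps gam v).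
Proof.
have r1 := trim_ratio_gt1 m eps0 gam0.
have Vs := valuation_sign v_sign.
have rr := close_refl n V (ltW r1).
have bound : forall L, {in L, forall g, (size g <= m)%N} ->
    spread_out n V (r * r) L -> (size L <= N)%N.
  by move=> L'; apply: spread_out_size.
have LN : (size L <= N)%N by exact: (size_level bound (leqnn m)).
pose T := ((10 + m.+1 * 30).+1 + (ccost setup + (m.+1 * (6 + level_const n * (N.+1 * N.+1)).+1 +
  (maxmin_const n * N.+1 + (select_const n * N.+1 + 50 * m.+1).+1).+1).+1).+1).+1.
have TT : (T <= algorithm_const * (m.+1 * (N.+1 * N.+1)))%N.
  rewrite /T /algorithm_const; set a := level_const n; set b := maxmin_const n.
  set c := select_const n; set N1 := N.+1; rewrite /=.
  have h1 : (1 <= N1 * N1)%N by rewrite muln_gt0.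
  have h2 : (N1 <= N1 * N1)%N by rewrite leq_pmulr.
  have h3 : (N1 * N1 <= m.+1 * (N1 * N1))%N by rewrite leq_pmull.
  have h4 : (m.+1 <= m.+1 * (N1 * N1))%N by rewrite leq_pmulr.
  have h5 : (b * N1 <= b * (m.+1 * (N1 * N1)))%N by rewrite leq_mul2l (leq_trans h2 h3) orbT.
  have h6 : (c * N1 <= c * (m.+1 * (N1 * N1)))%N by rewrite leq_mul2l (leq_trans h2 h3) orbT.
  have -> : (m.+1 * (6 + a * (N1 * N1)).+1 = m.+1 * 7 + a * (m.+1 * (N1 * N1)))%N.
    by rewrite -addSn mulnDr mulnCA.
  by rewrite !mulnDl; lia.
apply: (wp_le TT (fun _ => id)).
apply: wp_seq; apply: wp_le (leqnn _) _ (count_items_wp _ _) => // s1 [im1 r2 rm1].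
apply: wp_seq; apply: wp_run => //; set s2 := run setup s1.
have r3 : rmem s2 0 3 = r * r.
  rewrite /s2 /= /update /= r2 !rm1//=.
have rm2 b l : b != 0%N -> rmem s2 b l = rmem (input eps gam v) b l.
  by move=> b0; rewrite -rm1 ?b0// /s2 /= /update /= (negbTE b0).
have im2 k : imem s2 0 k = if k == 5%N then 1%N else if k == 4%N then 1%N
    else if k == 1%N then 0%N else imem (input eps gam v) 0 k.
  rewrite /s2 /= /update /=; case: ifP => // _; case: ifP => // _.
  by case: ifP => // /negbT /im1.
clearbody s2.
have at0 : at_level n m V (r * r) s2 [::] 0.
  split=> //=; try by rewrite im2.
  split=> //=; try by rewrite im2.
  + by move=> i j ni; rewrite rm2.
  (* The list starts with the empty assignment, whose loads are the untouched zeros of the arrays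
     beyond number [n]. *)
  + move=> [|//] q _ qn; rewrite rm2// load_nil /= nth_default//.
    rewrite [nth [::] _ _]nth_default// size_map size_enum_ord; lia.
  + by move=> [|//] _; left.
apply: wp_seq; apply: wp_le (leqnn _) _ (build_wp rr bound at0) => s3 [L0 [rep sJ sLO sHI]].
have ld : loads n V s3 (size L0) L.
  move=> d q dl qn; rewrite (rep_load rep) ?size_cat ?ltn_add2l//.
  by rewrite nth_cat ltnNge leq_addr/= addKn.
rewrite size_cat in sHI.
apply: wp_seq; apply: wp_le (leqnn _) _
  (maxmin_wp LN ld sLO sHI level_nonempty) => s4 [im4 rm4 mx4].
have ld4 : loads n V s4 (size L0) L by move=> d q dl qn; rewrite rm4// ld.
have sLO4 : imem s4 0 3 = size L0 by rewrite im4.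
have sHI4 : imem s4 0 4 = (size L0 + size L)%N by rewrite im4.
apply: wp_seq; apply: wp_le (leqnn _) _
  (select_wp LN ld4 sLO4 sHI4 level_nonempty mx4) => s5 [im5 [d [dl s5B] best]].
have GL : nth [::] L d \in L by exact: mem_nth.
have BT := @backtrack_wp R m s5 (L0 ++ L) (nth [::] L d).
apply: wp_le (leqnn _) _ (BT _ _ _ _ _).
- by move=> s6 out; exists (nth [::] L d).
- by move=> e el; rewrite !im5// !im4//; exact: (rep_parent rep).
- by rewrite im5// im4.
- by rewrite s5B size_cat ltn_add2l.
- by rewrite s5B nth_cat ltnNge leq_addr/= addKn.
- exact: level_size GL.
Qed.

Lemma maxmin_valueP i : (i < n)%N ->
  (forall h, h \in L -> exists2 k, (k < n)%N &
     load n V (i * n + k) h <= maxmin_value n V L i) /\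
  (exists2 h, h \in L & forall k, (k < n)%N ->
     maxmin_value n V L i <= load n V (i * n + k) h).
Proof.
move=> ni; rewrite /maxmin_value; split=> [h /(nthP [::])[d dl <-]|].
  have [k kn kd] := minf_ge (fun k => load n V (i * n + k) (nth [::] L d)) n0.
  exists k => //; apply: le_trans kd _.
  exact: (maxf_ge (fun d => min_load n V i (nth [::] L d)) dl).
have [d dl ->] := maxf_att (fun d => min_load n V i (nth [::] L d)) level_nonempty.
exists (nth [::] L d); first exact: mem_nth.
by move=> k kn; exact: (minf_le (fun k => load n V (i * n + k) (nth [::] L d))).
Qed.

Lemma algorithm_allocation (s : store R) :
  (exists G, [/\ G \in L,
       {in L, forall h, ~~ better n V (maxmin_value n V L) h G}
       & forall j, (j < m)%N -> imem s 1 j = nth 0%N G j]) ->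
  [/\ output n m s \in allocations n m,
      is_PO v gam (output n m s)
    & forall alpha A, 0 < alpha <= 1 -> A \in allocations n m ->
        is_MMS v alpha A -> is_MMS v (Num.max (alpha - eps) 0) (output n m s)].
Proof.
move=> [G [GL best out]].
have -> : output n m s = allocation_of n m G.
  by apply/ffunP => i; apply/finset.setP => j; rewrite !ffunE !inE out.
have r1 := trim_ratio_gt1 m eps0 gam0.
have Vs := valuation_sign v_sign.
pose c := r ^+ m.
have c1 : 1 <= c by rewrite exprn_ege1// ltW.
have Lok : {in L, forall g, size g = m /\ all (fun a => a < n)%N g}.
  by move=> g gL; split; [exact: level_size gL|exact: level_agents gL].
have Lcov g : size g = m -> all (fun a => a < n)%N g -> exists2 h, h \in L &
    forall q, (q < n * n)%N -> within c (load n V q h) (load n V q g).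
  by move=> gm gn; have := level_cover (ltW r1) Vs gn; rewrite gm.
set h := 1 + 3 / eps + 1 / gam.
have ch : c <= 1 + 1 / h by exact: trim_ratio_expr.
have e3 : 0 < 3 / eps by rewrite divr_gt0.
have g1 : 0 < 1 / gam by rewrite divr_gt0.
have h0 : 0 < h by rewrite /h; lra.
have cg : c <= 1 + gam.
  apply: le_trans ch _; rewrite lerD2l ler_pdivrMr//.
  have : gam * (1 / gam) = 1 by rewrite mulrC divfK// gt_eqF.
  move=> q; rewrite /h !mulrDr q mulr1 -[leLHS]add0r lerD2r.
  by rewrite addr_ge0// ltW// mulr_gt0.
have d1 : 1 / h <= 1 by rewrite ler_pdivrMr// /h; lra.
have d3 : 3 * (1 / h) <= eps.
  rewrite mulrA mulr1 ler_pdivrMr//.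
  have : eps * (3 / eps) = 3 by rewrite mulrC divfK// gt_eqF.
  move=> q; rewrite /h !mulrDr q mulr1 addrAC -[leLHS]add0r lerD2r.
  by rewrite addr_ge0// ltW// mulr_gt0.
have [Gm Gn] := Lok G GL.
split; first exact: allocation_ofP.
  exact: (selection_PO n0 valuationE Vs c1 Lok Lcov maxmin_valueP GL best).
move=> alpha A a01 AP AM.
apply: (selection_MMS n0 valuationE Vs c1 Lok Lcov maxmin_valueP GL best a01 AP AM).
have /andP[a0 a1] := a01.
have [ae|ae] := leP (alpha - eps) 0; first by rewrite mul0r ltW.
set d := 1 / h in ch d1 d3.
have dp : 0 <= d by rewrite divr_ge0// ltW.
(* From [c <= 1 + d] and [d <= 1]. As [alpha - eps <= 1] and [3 * d <= eps], the loss of [c * c]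
   fits into [eps]; this is where [eps / 3] comes from. *)
have cc : c * c <= 1 + 3 * d.
  apply: (@le_trans _ _ ((1 + d) * (1 + d))); first by rewrite ler_pM//; lra.
  have : d * d <= d by rewrite ler_piMl.
  by lra.
apply: (@le_trans _ _ ((alpha - eps) * (1 + 3 * d))); first by rewrite ler_wpM2l// ltW.
have : (alpha - eps) * (3 * d) <= 3 * d by rewrite ler_piMl//; lra.
by lra.
Qed.

(** Squaring the list bound doubles the exponent [n * n], one more factor [m + 1] counts the levels,
    and dividing by [ln 2] turns [expR] into a power of 2. *)
Lemma algorithm_time :
  (algorithm_const * (m.+1 * (N.+1 * N.+1)))%:R <=
  2 `^ (((n * n * 2)%:R / ln 2) / Num.min (eps ^+ 2) (gam ^+ 2)) *
  (((algorithm_const * 4 * 7 ^ (n * n * 2))%:R)%:P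
     * ('X + 1) ^+ (3 * (n * n * 2)).+1).[m%:R] :> R.
Proof.
set mu := Num.min _ _; set E := expR (1 / mu); set Q := (n * n)%N.
have ln2 : 0 < ln 2 :> R by rewrite ln_gt0// ltr1n.
have -> : 2 `^ (((Q * 2)%:R / ln 2) / mu) = E ^+ (Q * 2) :> R.
  rewrite /powR pnatr_eq0/= -expRM_natl; congr expR.
  by rewrite mulrAC divfK ?gt_eqF// mul1r.
rewrite hornerM hornerC horner_exp hornerD hornerX hornerC natr1.
set M := (m.+1)%:R; have M0 : 0 <= M :> R by exact: ler0n.
have NE : N%:R <= (7 * M ^+ 3 * E) ^+ Q :> R by exact: level_bound_le.
have N1 : (N.+1)%:R <= 2 * (N%:R : R).
  rewrite -natrM ler_nat mul2n -addnn -addn1 leq_add2l.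
  by rewrite /level_bound expn_gt0.
have NN : (N.+1)%:R * (N.+1)%:R <= 4 * (7 * M ^+ 3 * E) ^+ (Q * 2) :> R.
  rewrite exprM expr2 -natrM.
  have := ler_pM (ler0n R N) (ler0n R N) NE NE.
  have := ler_pM (ler0n R N.+1) (ler0n R N.+1) N1 N1.
  by rewrite natrM; lra.
rewrite !natrM natrX.
apply: (@le_trans _ _ (algorithm_const%:R * (M * (4 * (7 * M ^+ 3 * E) ^+ (Q * 2))))).
  by rewrite ler_wpM2l// ler_wpM2l.
rewrite [(7 * _ * E) ^+ _]exprMn [(7 * _) ^+ _]exprMn -[(M ^+ 3) ^+ _]exprM.
rewrite [M ^+ _.+1]exprS le_eqVlt; apply/orP; left; apply/eqP.
by ring.
Qed.

End Algorithm.

Theorem mainTheorem6 (R : realType) (n : nat) (hn : (0 < n)%N) :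
  exists c : R, 0 < c /\
  exists (P : cmd) (K : R) (p : {poly R}),
  forall (eps gam : R) (m : nat) (v : 'I_n -> 'I_m -> R),
    0 < eps -> 0 < gam -> goods_manna v \/ chores_manna v ->
    exists (t : nat) (s : store R),
      [/\ exec P (input eps gam v) t s,
          t%:R <= 2 `^ (K / Num.min (eps ^+ 2) (gam ^+ 2)) * p.[m%:R],
          output n m s \in allocations n m
        & exists alpha : R,
          [/\ 0 < alpha <= 1,
              is_MMS v (Num.max (alpha - eps) 0) (output n m s),
              is_PO v gam (output n m s)
            & forall alpha' : R, 0 < alpha' <= 1 ->
                alpha + (2 `^ (m%:R `^ c))^-1 < alpha' ->
                ~ exists A : {ffun 'I_n -> {set 'I_m}},
                    A \in allocations n m /\ is_MMS v alpha' A]].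
Proof.
exists 1; split=> //; exists (algorithm n), ((n * n * 2)%:R / ln 2).
exists (((algorithm_const n * 4 * 7 ^ (n * n * 2))%:R)%:P
     * ('X + 1) ^+ (3 * (n * n * 2)).+1).
move=> eps gam m v e0 g0 vs.
have [t [s [E tT H]]] := algorithm_wp hn e0 g0 vs.
have [AP PO MMSA] := algorithm_allocation hn e0 g0 vs H.
exists t, s; split=> //.
  by apply: (le_trans _ (algorithm_time n m e0 g0)); rewrite ler_nat.
(* The achievable ratios; their supremum need not be shown to be attained, as the slack leaves room
   for an element of [S] close to it. *)
pose S : set R := fun a => 0 < a <= 1 /\
  exists A, A \in allocations n m /\ is_MMS v a A.
set slack := (2 `^ _)^-1.
have slack0 : 0 < slack by rewrite invr_gt0 powR_gt0.
have [[a Sa]|S0] := pselect (exists a, S a); last first.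
  (* With no achievable ratio at all, this choice makes [alpha - eps] at most 0, where the MMS
     guarantee holds by convention. *)
  exists (Num.min 1 eps); split=> //.
  - by rewrite lt_min ltr01 e0 ge_min lexx.
  - have -> : Num.max (Num.min 1 eps - eps) 0 = 0.
      by apply/max_idPr; rewrite subr_le0 ge_min lexx orbT.
    by move=> +; rewrite ltxx.
  - by move=> a' a'01 _ ex; apply: S0; exists a'.
have supS : has_sup S by split; [exists a|exists 1 => b [/andP[]]].
(* [alpha] is achievable and exceeds the supremum minus the slack, so any ratio above
   [alpha + slack] would exceed the supremum. *)
have [alpha [a01 [A [AP' AM]]] aS] := sup_adherent slack0 supS.
exists alpha; split=> //; first exact: MMSA a01 AP' AM.
move=> a' a'01 aa' ex.
have : a' <= sup S by apply: ub_le_sup => //; case: supS.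
by lra.
Qed.
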